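(* Let $\mathcal{X}$ be a finite set with $|\mathcal{X}|\ge 2$ and let $\mathcal{E}\subset\mathcal{X}^2$ be such that the directed graph $(\mathcal{X},\mathcal{E})$ is strongly connected. Let $M=\{w_\theta:\theta\in\mathbb{R}^d\}\subset\mathcal{W}(\mathcal{X},\mathcal{E})$ be a $d$-dimensional exponential family with $$\log w_\theta(y|x)=C(x,y)+\sum_{i=1}^d\theta^iF_i(x,y)+K_\theta(y)-K_\theta(x)-\psi(\theta)\qquad((x,y)\in\mathcal{E},\ \theta\in\mathbb{R}^d).$$ Then both the exponential connection $\nabla^{(\mathrm{e})}$ and the mixture connection $\nabla^{(\mathrm{m})}$ on $M$ are flat, and the natural parameter $(\theta^i)$ and the expectation parameter $(\eta_i)$ are affine coordinate systems of $\nabla^{(\mathrm{e})}$ and $\nabla^{(\mathrm{m})}$, respectively.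
   Context: Strongly connected means: for any $(x,y)\in\mathcal{X}^2$ there is a sequence $(x_1,x_2),\ldots,(x_{n-1},x_n)$ in $\mathcal{E}$ with $n\ge2$, $x_1=x$, $x_n=y$. A Markov kernel on $\mathcal{X}$ is a map $w:\mathcal{X}^2\to[0,1]$, $(x,y)\mapsto w(y|x)$, with $\sum_y w(y|x)=1$ for every $x$. $\mathcal{W}(\mathcal{X},\mathcal{E})$ is the set of Markov kernels $w$ with $\{(x,y):w(y|x)>0\}=\mathcal{E}$. Each $w\in\mathcal{W}(\mathcal{X},\mathcal{E})$ is irreducible and so has a unique stationary distribution $p_w$ on $\mathcal{X}$; put $p_w^{(2)}(x,y)=p_w(x)w(y|x)$. A $d$-dimensional exponential family with natural parameter $\theta=(\theta^1,\ldots,\theta^d)$ is a family $\{w_\theta:\theta\in\mathbb{R}^d\}\subset\mathcal{W}(\mathcal{X},\mathcal{E})$, with $\theta\mapsto w_\theta$ injective, for which there exist functions $C,F_1,\ldots,F_d:\mathcal{E}\to\mathbb{R}$, $K:\mathcal{X}\times\mathbb{R}^d\to\mathbb{R}$, $(x,\theta)\mapsto K_\theta(x)$, and $\psi:\mathbb{R}^d\to\mathbb{R}$ satisfying the displayed formula. Its expectation parameter is $\eta=(\eta_1,\ldots,\eta_d)$, $\eta_i(\theta)=\sum_{(x,y)\in\mathcal{E}}p^{(2)}_{w_\theta}(x,y)F_i(x,y)$, which forms another (global) coordinate system of $M$. For a $d$-dimensional parametric family $\{w_\xi\}\subset\mathcal{W}(\mathcal{X},\mathcal{E})$ with coordinates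 $\xi=(\xi^1,\ldots,\xi^d)$, $\partial_i=\partial/\partial\xi^i$ and $p_\xi(x,y)=p^{(2)}_{w_\xi}(x,y)$, the Fisher metric is the Riemannian metric $$g_{ij}=g(\partial_i,\partial_j)=\sum_{(x,y)\in\mathcal{E}}p_\xi(x,y)\,\partial_i\log w_\xi(y|x)\,\partial_j\log w_\xi(y|x),$$ and the exponential connection $\nabla^{(\mathrm{e})}$ and mixture connection $\nabla^{(\mathrm{m})}$ are the affine connections defined by $$\Gamma^{(\mathrm{e})}_{ij,k}=g(\nabla^{(\mathrm{e})}_{\partial_i}\partial_j,\partial_k)=\sum_{(x,y)\in\mathcal{E}}\partial_i\partial_j\log w_\xi(y|x)\,\partial_kp_\xi(x,y),$$ $$\Gamma^{(\mathrm{m})}_{ij,k}=g(\nabla^{(\mathrm{m})}_{\partial_i}\partial_j,\partial_k)=\sum_{(x,y)\in\mathcal{E}}\partial_i\partial_jp_\xi(x,y)\,\partial_k\log w_\xi(y|x).$$ These do not depend on the choice of coordinates. A coordinate system $\xi$ is affine for a connection $\nabla$ if $\nabla_{\partial_i}\partial_j=0$ for all $i,j$ in that coordinate system; $\nabla$ is flat if its torsion and curvature vanish (equivalently, affine coordinate systems exist locally around every point). *)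

(* Defs.v *)
From HB Require Import structures.
From mathcomp Require Import all_boot all_order all_algebra.
From mathcomp Require Import all_classical all_reals all_analysis.

Set Implicit Arguments.
Unset Strict Implicit.
Unset Printing Implicit Defensive.

Import Order.TTheory GRing.Theory Num.Theory.
Import numFieldNormedType.Exports.

Local Open Scope classical_set_scope.
Local Open Scope ring_scope.

Section MarkovKernels.
Context {R : realType} {X : finType}.
Implicit Types (E : rel X) (w : X -> X -> R) (p : {ffun X -> R}).

(* The path is x :: s; requiring s nonempty makes the case x = y ask for
   an actual closed walk. *)
Definition strongly_connected E : Prop :=
  forall x y, exists s : seq X, [/\ s <> [::], path E x s & last x s = y].

(* Kernels are written source first: w x y stands for w(y|x). *)
Definition markov_kernel w : Prop :=
  (forall x y, 0 <= w x y <= 1) /\ (forall x, \sum_y w x y = 1).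

Definition kernel_on E w : Prop :=
  markov_kernel w /\ (forall x y, (0 < w x y) = E x y).

Definition is_stationary w p : Prop :=
  [/\ forall x, 0 <= p x, \sum_x p x = 1 &
      forall y, \sum_x p x * w x y = p y].

(* Well defined for irreducible w, whose stationary distribution exists and
   is unique; the default 0 is returned when there is none. *)
Definition stationary w : {ffun X -> R} := xget [ffun=> 0] (is_stationary w).

Definition pair_dist w (x y : X) : R := stationary w x * w x y.

End MarkovKernels.

Section CoordinateCalculus.
Context {R : realType} {d : nat}.
Local Notation V := 'rV[R]_d.
Implicit Types (U : set V) (f : V -> R) (Y Z : V -> V).

Definition basis (i : 'I_d) : V := delta_mx 0 i.

Definition partial (i : 'I_d) f : V -> R := fun x => 'D_(basis i) f x.

(* C^infinity on the open set U: all iterated partial derivatives exist and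
   are continuous at the points of U. *)
Definition smooth_on U f : Prop :=
  forall (s : seq 'I_d) x, U x ->
    {for x, continuous (foldr partial f s)} /\
    (forall i, derivable (foldr partial f s) x (basis i)).

Definition smooth_map_on U Y : Prop :=
  forall l, smooth_on U (fun x => Y x 0 l).

(* xi is a diffeomorphism from the open set U onto the open set xi @` U, and
   phi is its inverse. Only the values of phi on xi @` U matter. *)
Definition coordinate_change U (xi phi : V -> V) : Prop :=
  [/\ open U, open (xi @` U), (forall x, U x -> phi (xi x) = x),
      smooth_map_on U xi & smooth_map_on (xi @` U) phi].

(* Connection coefficients in a coordinate system: G i j l is the component
   along the l-th coordinate field of the covariant derivative of the j-th
   coordinate field along the i-th. Vector fields are given by their
   components in the same coordinates. *)
Definition coefficients := 'I_d -> 'I_d -> 'I_d -> V -> R.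
Implicit Type G : coefficients.

Definition covariant G Y Z : V -> V := fun x =>
  \row_l \sum_i Y x 0 i *
    (partial i (fun x' => Z x' 0 l) x + \sum_j Z x 0 j * G i j l x).

Definition bracket Y Z : V -> V := fun x =>
  \row_l \sum_i (Y x 0 i * partial i (fun x' => Z x' 0 l) x -
                 Z x 0 i * partial i (fun x' => Y x' 0 l) x).

Definition torsion G Y Z : V -> V := fun x =>
  covariant G Y Z x - covariant G Z Y x - bracket Y Z x.

Definition curvature G Y Z (T : V -> V) : V -> V := fun x =>
  covariant G Y (covariant G Z T) x - covariant G Z (covariant G Y T) x
  - covariant G (bracket Y Z) T x.

Definition flat_on U G : Prop :=
  forall Y Z T : V -> V,
    smooth_map_on U Y -> smooth_map_on U Z -> smooth_map_on U T ->
    forall x, U x -> torsion G Y Z x = 0 /\ curvature G Y Z T x = 0.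

End CoordinateCalculus.

Section InformationGeometry.
Context {R : realType} {X : finType} {d : nat}.
Local Notation V := 'rV[R]_d.

Definition family := V -> X -> X -> R.
Implicit Types (E : rel X) (w : family).

Definition log_kernel w (x y : X) : V -> R := fun t => ln (w t x y).

Definition pair_prob w (x y : X) : V -> R := fun t => pair_dist (w t) x y.

Definition fisher E w (t : V) : 'M[R]_d :=
  \matrix_(i, j) \sum_x \sum_(y | E x y)
    pair_prob w x y t *
    partial i (log_kernel w x y) t * partial j (log_kernel w x y) t.

Definition Gamma_e E w (i j k : 'I_d) (t : V) : R :=
  \sum_x \sum_(y | E x y)
    partial i (partial j (log_kernel w x y)) t *
    partial k (pair_prob w x y) t.

Definition Gamma_m E w (i j k : 'I_d) (t : V) : R :=
  \sum_x \sum_(y | E x y)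
    partial i (partial j (pair_prob w x y)) t *
    partial k (log_kernel w x y) t.

(* The lower-index symbols above are g(nabla_i d_j, d_k); raising k with the
   inverse of the Fisher metric gives the connection itself. *)
Definition raise E w (H : 'I_d -> 'I_d -> 'I_d -> V -> R) :
    @coefficients R d :=
  fun i j l t => \sum_k H i j k t * invmx (fisher E w t) k l.

Definition exp_connection E w : coefficients := raise E w (Gamma_e E w).

Definition mix_connection E w : coefficients := raise E w (Gamma_m E w).

(* The smooth family has a positive definite Fisher matrix at every point, so
   that the partial derivatives and the inverse matrix above are genuine. *)
Definition riemannian_family E w : Prop :=
  (forall x y, smooth_on [set: V] (fun t => w t x y)) /\
  (forall t (v : V), v != 0 -> 0 < (v *m fisher E w t *m v^T) 0 0).

(* The parameter t of w is a global coordinate system of M = {w t}. Any other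
   (possibly local) coordinate system of M is xi : U -> R^d with inverse phi;
   in it the family reads w \o phi. A connection on M is a rule Conn giving
   the coefficients in each coordinate system. *)
Definition flat w (Conn : family -> coefficients) : Prop :=
  forall U (xi phi : V -> V), coordinate_change U xi phi ->
    flat_on (xi @` U) (Conn (w \o phi)).

Definition affine_coordinates w (Conn : family -> coefficients)
    (xi : V -> V) : Prop :=
  exists2 phi : V -> V, coordinate_change [set: V] xi phi &
    forall (i j : 'I_d) x, range xi x ->
      covariant (Conn (w \o phi)) (fun=> basis i) (fun=> basis j) x = 0.

(* C, F_i, K_t and psi are total functions; the values of C and F_i outside E
   are irrelevant. *)
Definition exponential_family E w (C : X -> X -> R)
    (F : 'I_d -> X -> X -> R) (K : V -> X -> R) (psi : V -> R) : Prop :=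
  [/\ forall t, kernel_on E (w t), injective w &
      forall t x y, E x y ->
        ln (w t x y) =
          C x y + \sum_i t 0 i * F i x y + K t y - K t x - psi t].

Definition expectation_parameter E w (F : 'I_d -> X -> X -> R) : V -> V :=
  fun t => \row_i \sum_x \sum_(y | E x y) pair_prob w x y t * F i x y.

End InformationGeometry.

(* Main.v *)
(* Write J for the Jacobian of the natural parameter theta and N for that of the
   expectation parameter eta in an arbitrary chart. A function K(y) - K(x) - c
   pairs to a constant with the pair distribution, so the log-linear form of
   the kernels gives
     g = J N^T, Gamma^e_ij = (d_i d_j theta) N^T, Gamma^m_ij = (d_i d_j eta) J^T.
   Raising the last index with g^-1 leaves (d_i d_j theta) J^-1 and
   (d_i d_j eta) N^-1: theta and eta are affine, and both connections are flat.

   Smoothness: normalised at a base point, the potentials K_t and psi_t solve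
   the equations saying that rows sum to 1. By the maximum principle their
   left-hand side is injective with invertible derivative, so the inverse
   function theorem makes K smooth; the stationary distribution is a rational
   function of the kernel. Positivity of g: if v g v^T = 0 then the combination
   v . F is a coboundary up to a constant, hence w_(t+v) = w_t and v = 0. Since
   g is the Jacobian of eta, eta is strictly monotone, hence injective, and the
   inverse function theorem makes it a global chart. *)
Require Import Defs.
From HB Require Import structures.
From mathcomp Require Import all_boot all_order all_algebra.
From mathcomp Require Import all_classical all_reals all_analysis.
From mathcomp Require Import ring lra.

Set Implicit Arguments.
Unset Strict Implicit.
Unset Printing Implicit Defensive.

Import Order.TTheory GRing.Theory Num.Theory.
Import numFieldNormedType.Exports.
Local Open Scope classical_set_scope.
Local Open Scope ring_scope.
Local Notation basis := Defs.basis.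

(** * Calculus on row vectors *)

(** An exponential family is given pointwise in [t]: [K] and [psi] come without regularity, and [K]
    is free up to a constant depending on [t]. Smoothness must therefore be extracted from the
    normalisation of the rows before any derivative in the metric or the connections carries
    meaning. Since [smooth_on] speaks only of iterated partial derivatives, the chain rule, the
    symmetry of second derivatives and the inverse function theorem rest on mean values along the
    axes rather than on total derivatives. Flatness is asked in every local chart and for all smooth
    vector fields. Instead of differentiating connection coefficients, vectors are tested on the
    affine coordinate functions [phi_ a]: there the covariant derivative of [Z] along [Y] becomes
    the iterated derivative [Y (Z (phi_ a))], and torsion and curvature both reduce to the
    commutator formula for the bracket. Invertibility of the Jacobian makes these tests
    sufficient. *)

Section RowVectors.
Context {R : realType}.

Lemma coord_le_norm n (v : 'rV[R]_n) i : `|v 0 i| <= `|v|.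
Proof.
by rewrite [leRHS]/Num.Def.normr/= mx_normrE; exact: (le_bigmax _ _ (0, i)).
Qed.

Lemma norm_le_coord n (v : 'rV[R]_n) e :
  0 <= e -> (forall i, `|v 0 i| <= e) -> `|v| <= e.
Proof.
move=> e0 ve; rewrite [leLHS]/Num.Def.normr/= mx_normrE bigmax_le// => -[i j] _.
by rewrite ord1.
Qed.

Lemma cvg_row (T : Type) (F : set_system T) {FF : Filter F} n
    (f : T -> 'rV[R]_n) (l : 'rV[R]_n) :
  (forall i, (fun t => f t 0 i) @ F --> l 0 i) -> f @ F --> l.
Proof.
move=> fl; apply/cvgrPdist_le => e e0.
have /filter_forall : forall i, \forall t \near F, `|l 0 i - f t 0 i| <= e.
  by move=> i; exact: ((cvgrPdist_le _ _).1 (fl i)).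
apply: filterS => t le; apply: norm_le_coord (ltW e0) _ => i.
by rewrite !mxE.
Qed.

Lemma cvg_sum (T : Type) (F : set_system T) {FF : Filter F} (I : Type)
    (r : seq I) (P : pred I) (f : I -> T -> R) (l : I -> R) :
  (forall i, P i -> f i @ F --> l i) ->
  (fun t => \sum_(i <- r | P i) f i t) @ F --> \sum_(i <- r | P i) l i.
Proof. by move=> fl; apply: cvg_big fl; exact: add_continuous. Qed.

Lemma cvg_prod (T : Type) (F : set_system T) {FF : Filter F} (I : Type)
    (r : seq I) (P : pred I) (f : I -> T -> R) (l : I -> R) :
  (forall i, P i -> f i @ F --> l i) ->
  (fun t => \prod_(i <- r | P i) f i t) @ F --> \prod_(i <- r | P i) l i.
Proof. by move=> fl; apply: cvg_big fl; exact: mul_continuous. Qed.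

Lemma cvg_det (T : Type) (F : set_system T) {FF : Filter F} m
    (A : T -> 'M[R]_m) (B : 'M[R]_m) :
  (forall i j, (fun t => A t i j) @ F --> B i j) ->
  (fun t => \det (A t)) @ F --> \det B.
Proof.
move=> AB; apply: cvg_sum => s _; apply: cvgM; first exact: cvg_cst.
by apply: cvg_prod.
Qed.

(** The approximants are written by Cramer's rule because [invmx] is defined by cases: on a singular
    [A t] it returns [A t] itself, and [A t] is only eventually invertible. *)
Lemma cvg_invmx (T : Type) (F : set_system T) {FF : Filter F} m
    (A : T -> 'M[R]_m) (B : 'M[R]_m) i j : B \in unitmx ->
  (forall i j, (fun t => A t i j) @ F --> B i j) ->
  (fun t => (\det (A t))^-1 * (\adj (A t)) i j) @ F --> (invmx B) i j.
Proof.
move=> uB AB; rewrite /invmx uB mxE.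
apply: cvgM; first by apply: cvgV; [rewrite -unitfE -unitmxE|exact: cvg_det].
rewrite [X in _ --> X]mxE; under eq_fun do rewrite mxE.
apply: cvgM; first exact: cvg_cst.
apply: cvg_det => i' j'; rewrite !mxE; under eq_fun do rewrite !mxE.
exact: AB.
Qed.

Lemma nbhs_rowP n (x : 'rV[R]_n) (P : set 'rV[R]_n) :
  nbhs x P <-> exists2 r, 0 < r & forall y, `|y - x| < r -> P y.
Proof.
split=> [/nbhs_normP[r r0 rP]|[r r0 rP]].
  by exists r => // y yx; apply: rP; rewrite /ball_ /= distrC.
by apply: (nbhs_normP x P).2; exists r => // y; rewrite /ball_ /= distrC;
  exact: rP.
Qed.

Lemma cvg_rowP n (x : 'rV[R]_n) (f : 'rV[R]_n -> R) (l : R) :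
  f @ x --> l <->
  forall e, 0 < e -> exists2 r, 0 < r & forall y, `|y - x| < r -> `|f y - l|
    < e.
Proof.
split=> [fl e e0|fl].
  apply/(nbhs_rowP x (fun y => `|f y - l| < e)).
  exact: ((cvgrPdistC_lt (F := nbhs x) f l).1 fl e e0).
apply: (cvgrPdistC_lt (F := nbhs x) _ _).2 => e /fl.
by move=> /(nbhs_rowP x (fun y => `|f y - l| < e)).
Qed.

Lemma norm_basis n (i : 'I_n) : `|basis i : 'rV[R]_n| <= 1.
Proof.
apply: norm_le_coord => // j; rewrite mxE/=.
by case: (j == i); rewrite ?normr1 ?normr0.
Qed.

End RowVectors.

(** * Differentiation along a line in a normed space *)

Section Lines.
Context {R : realType} {V : normedModType R}.
Implicit Types (f : V -> R) (x z v : V).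

Lemma is_derive_line f z v (s : R) : derivable f (z + s *: v) v ->
  is_derive s 1 (fun s => f (z + s *: v)) ('D_v f (z + s *: v)).
Proof.
move=> df.
have E : (fun h : R => h^-1 *: (((fun s => f (z + s *: v)) \o shift s) (h *: 1)
   - f (z + s *: v))) =
   (fun h => h^-1 *: ((f \o shift (z + s *: v)) (h *: v) - f (z + s *: v))).
  apply/funext => h /=; rewrite [h%:A]mulr1; congr (_ *: (f _ - _)).
  by rewrite scalerDl addrCA.
by split; rewrite /derivable /derive E.
Qed.

(** Homogeneity in the direction, [k = 0] included, comes from the one-variable chain rule for
    [h -> k * h] followed by the restriction of [f] to the line. *)
Lemma is_derive_scale f x v (k : R) : derivable f x v ->
  is_derive x (k *: v) f (k * 'D_v f x).
Proof.
move=> df.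
have df0 : derivable f (x + 0 *: v) v by rewrite scale0r addr0.
have := is_derive_line df0; rewrite scale0r addr0 => dl.
have dk : is_derive (0 : R) 1 (fun h : R => k * h) k.
  have -> : (fun h : R => k * h) = k \*: (id : R -> R) by apply/funext.
  by apply: is_derive_eq; rewrite [LHS]mulr1.
have dl' : is_derive (k * 0 : R) 1 (fun s => f (x + s *: v)) ('D_v f x).
  by rewrite mulr0.
have [D1 D2] := is_derive1_comp dl' dk.
have E : ((fun s => f (x + s *: v)) \o (fun h : R => k * h)) =
         (fun h => f (h *: (k *: v) + x)).
  by apply/funext => h /=; rewrite addrC scalerA mulrC.
have D3 : derivable f x (k *: v) by apply/derivable1P; rewrite -E.
split=> //; have D2' := D2; rewrite mulrC in D2'.
have D3' : derivable f (x + 0 *: (k *: v)) (k *: v) by rewrite scale0r addr0.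
have [_] := is_derive_line D3'; rewrite scale0r addr0 => <-.
rewrite -[RHS]D2'; apply: (congr1 (fun g : R -> R => 'D_(1 : R) g 0)).
by rewrite E; apply/funext => h; rewrite addrC.
Qed.

Lemma MVT_line f z v :
  (forall s : R, 0 <= s <= 1 -> derivable f (z + s *: v) v) ->
  exists2 s : R, 0 <= s <= 1 & f (z + v) - f z = 'D_v f (z + s *: v).
Proof.
move=> df; pose g (s : R) := f (z + s *: v).
have dg (s : R) : 0 <= s <= 1 -> is_derive s 1 g ('D_v f (z + s *: v)).
  by move=> s01; apply: is_derive_line; exact: df.
have dg1 (s : R) : s \in `]0, 1[ -> is_derive s 1 g ('D_v f (z + s *: v)).
  by move=> s01; apply: dg; rewrite !ltW ?(itvP s01).
have gc : {within `[0 : R, 1], continuous g}.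
  apply: derivable_within_continuous => s s01.
  by apply: ex_derive; apply: dg; rewrite !(itvP s01).
have [s] := MVT_segment ler01 dg1 gc.
rewrite in_itv/= => s01; rewrite subr0 mulr1 /g scale1r scale0r addr0 => E.
by exists s.
Qed.

Lemma continuous_along f x v : derivable f x v ->
  (fun h : R => f (h *: v + x)) @ (0 : R) --> f x.
Proof.
move=> /derivable1P/derivable1_diffP/differentiable_continuous cf.
have : {for 0, continuous (fun h : R => f (h *: v + x))} by exact: cf.
by rewrite /prop_for /continuous_at /= scale0r add0r.
Qed.

Lemma is_derive_translate f c x v : derivable f (x + c) v ->
  is_derive x v (fun y => f (y + c)) ('D_v f (x + c)).
Proof.
move=> df.
have E : (fun h : R => h^-1 *: (((fun y => f (y + c)) \o shift x) (h *: v)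
   - f (x + c))) =
   (fun h => h^-1 *: ((f \o shift (x + c)) (h *: v) - f (x + c))).
  by apply/funext => h /=; rewrite addrA.
by split; rewrite /derivable /derive E.
Qed.

End Lines.

(** * Partial derivatives and functions of class C^k on open sets *)

Section Partials.
Context {R : realType}.

Local Lemma double_difference (a b c d : R) : a - b - (c - d) = a - c - (b - d).
Proof. by ring. Qed.

Local Lemma midpoint_bound (a b c e : R) :
  `|c - a| < e / 2 -> `|c - b| < e / 2 -> `|b - a| <= e.
Proof. by rewrite !ltr_norml => /andP[? ?] /andP[? ?]; rewrite ler_norml;
  lra. Qed.

(** The walk from [x0] to [x] through the corners [z x k] changes one coordinate at a time, and the
    mean value theorem applies on each leg. No leg leaves the ball of radius [|x - x0|] because the
    norm is the sup norm. *)
Lemma hadamard n (f : 'rV[R]_n -> R) (x0 : 'rV[R]_n) (r : R) :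
  (forall x, `|x - x0| < r -> forall i, derivable f x (basis i)) ->
  exists xi : 'rV[R]_n -> 'I_n -> 'rV[R]_n, forall x, `|x - x0| < r ->
    (forall i, `|xi x i - x0| <= `|x - x0|) /\
    f x - f x0 = \sum_i (x - x0) 0 i * partial i f (xi x i).
Proof.
move=> df.
pose z x k : 'rV[R]_n := x0 + \row_i (if (i < k)%N then (x - x0) 0 i else 0).
have zS x (i : 'I_n) : z x i.+1 = z x i + (x - x0) 0 i *: basis i.
  apply/rowP => j; rewrite !mxE eqxx/= -addrA; congr (_ + _).
  rewrite ltnS leq_eqVlt; have [->|ji] := eqVneq j i.
    by rewrite eqxx ltnn/= add0r mulr1.
  by rewrite -[(j == i :> nat)]/(j == i) (negbTE ji) mulr0n mulr0 addr0.
have zle x (i : 'I_n) (s : R) : 0 <= s <= 1 ->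
    `|z x i + s *: ((x - x0) 0 i *: basis i) - x0| <= `|x - x0|.
  move=> /andP[s0 s1]; apply: norm_le_coord => // j.
  have := coord_le_norm (x - x0) j; rewrite !mxE/= -/(x - x0).
  rewrite [x0 0 j + _]addrC addrAC addrK -!/(x - x0).
  have [->|ji] := eqVneq j i.
    rewrite ltnn add0r mulr1; apply: le_trans.
    by rewrite normrM ger0_norm// ler_piMl.
  by rewrite mulr0n !mulr0 addr0; case: ifP => // _; rewrite normr0.
(* The ball condition sits under the existential so that [choice] applies to all [x]; outside the
   ball [x0] is a dummy value. *)
have step (p : 'rV[R]_n * 'I_n) : exists y, `|p.1 - x0| < r ->
    `|y - x0| <= `|p.1 - x0| /\
    f (z p.1 p.2.+1) - f (z p.1 p.2) = (p.1 - x0) 0 p.2 * partial p.2 f y.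
  case: p => x i /=; have [xr|] := boolP (`|x - x0| < r); last by exists x0.
  have dz (s : R) : 0 <= s <= 1 ->
      derivable f (z x i + s *: ((x - x0) 0 i *: basis i)) (basis i).
    by move=> s01; apply: df; exact: le_lt_trans (zle _ _ _ s01) xr.
  have [s s01 E] := MVT_line (fun s s01 => @ex_derive _ _ _ _ _ _ _
    (is_derive_scale ((x - x0) 0 i) (dz s s01))).
  exists (z x i + s *: ((x - x0) 0 i *: basis i)) => _; split; first exact: zle.
  by rewrite zS E; have [_ ->] := is_derive_scale ((x - x0) 0 i) (dz s s01).
have [xi xiP] := choice step.
exists (fun x i => xi (x, i)) => x xr; split=> [i|].
  by have [] := xiP (x, i) xr.
have -> : f x - f x0 = f (z x n) - f (z x 0%N).
  congr (f _ - f _); apply/rowP => i; rewrite !mxE ?ltn_ord ?addr0//.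
  by rewrite addrCA subrr addr0.
rewrite -(@telescope_sumr _ 0 n (fun k => f (z x k)))// big_mkord.
by apply: eq_bigr => i _; have [_] := xiP (x, i) xr.
Qed.

(** Smoothness is graded by order because products, composites and inverses are handled by
    induction: their partial derivatives involve the original functions one order lower. *)
Fixpoint Ck n k (U : set 'rV[R]_n) (f : 'rV[R]_n -> R) : Prop :=
  if k is k'.+1 then
    (forall x, U x -> {for x, continuous f} /\
                      forall i, derivable f x (basis i)) /\
    forall i, Ck k' U (partial i f)
  else forall x, U x -> {for x, continuous f}.

Lemma Ck_continuous n k U (f : 'rV[R]_n -> R) x :
  Ck k U f -> U x -> {for x, continuous f}.
Proof. by case: k => [cf|k [cf _]] Ux; [exact: cf|case: (cf x Ux)]. Qed.

Lemma CkS n k U (f : 'rV[R]_n -> R) : Ck k.+1 U f -> Ck k U f.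
Proof.
elim: k f => [|k IH] f [cf Cf]; first by move=> x /cf[].
by split=> // i; apply: IH; exact: Cf.
Qed.

Lemma Ck1 n k U (f : 'rV[R]_n -> R) : Ck k.+1 U f -> Ck 1 U f.
Proof. by move=> [cf Cf]; split=> // i x Ux; exact: (Ck_continuous (Cf i)). Qed.

Lemma smooth_onP n U (f : 'rV[R]_n -> R) :
  smooth_on U f <-> forall k, Ck k U f.
Proof.
split=> [sf k|Cf s].
  elim: k f sf => [|k IH] f sf; first by move=> x Ux; case: (sf [::] x Ux).
  split=> [x Ux|i]; first exact: (sf [::] x Ux).
  apply: IH => s x Ux; have := sf (rcons s i) x Ux.
  by rewrite foldr_rcons.
(* [foldr] applies the last index of the list first, hence the induction from the right. *)
elim/last_ind: s f Cf => [|s i IH] f Cf x Ux.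
  by have [/(_ _ Ux)] := Cf 1%N.
by rewrite foldr_rcons; exact: (IH _ (fun k => (Cf k.+1).2 i) x Ux).
Qed.

(* Caratheodory's form of differentiability. *)
Lemma C1_slopes n (U : set 'rV[R]_n) (f : 'rV[R]_n ->
  R) (x0 : 'rV[R]_n) : open U -> Ck 1 U f -> U x0 ->
  exists Q : 'I_n -> 'rV[R]_n -> R,
    (forall i, Q i @ x0 --> partial i f x0) /\
    \forall x \near x0, f x - f x0 = \sum_i (x - x0) 0 i * Q i x.
Proof.
move=> oU [cf Cf] Ux0.
have /nbhs_rowP[r r0 rU] : nbhs x0 U by exact: open_nbhs_nbhs.
have [|xi xiP] := @hadamard n f x0 r.
  by move=> x /rU Ux; have [] := cf x Ux.
exists (fun i x => partial i f (xi x i)); split; last first.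
  by apply/nbhs_rowP; exists r => // x /xiP[].
move=> i; apply/cvg_rowP => e e0.
have /cvg_rowP/(_ _ e0)[s s0 sf] := Cf i x0 Ux0.
exists (Num.min r s) => [|x]; first by rewrite lt_min r0.
rewrite lt_min => /andP[/xiP[xix _] xs]; apply: sf.
exact: le_lt_trans (xix i) xs.
Qed.

(** The inner map is only differentiable along [v], so the slopes of [f] at [phi x] are evaluated on
    the curve [h -> phi (h *: v + x)]. This curve tends to [phi x], and the difference quotient is a
    sum of products with known limits. *)
Lemma is_derive_comp_row (W : normedModType R) n (U : set 'rV[R]_n) (f :
  'rV[R]_n -> R)
    (phi : W -> 'rV[R]_n) (x v : W) :
  open U -> Ck 1 U f -> U (phi x) ->
  (forall a, derivable (fun t => phi t 0 a) x v) ->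
  is_derive x v (f \o phi)
    (\sum_a 'D_v (fun t => phi t 0 a) x * partial a f (phi x)).
Proof.
move=> oU Cf Ux dphi.
have [Q [Qc Qf]] := C1_slopes oU Cf Ux.
have cphi : (fun h : R => phi (h *: v + x)) @ (0 : R) --> phi x.
  by apply: cvg_row => a; apply: (@continuous_along _ _ (fun t => phi t 0 a)).
have cphi' : (fun h : R => phi (h *: v + x)) @ (0 : R)^' --> phi x.
  exact: cvg_within_filter cphi.
have D : (fun h : R => h^-1 *: (((f \o phi) \o shift x) (h *: v)
      - (f \o phi) x))
    @ 0^' --> \sum_a 'D_v (fun t => phi t 0 a) x * partial a f (phi x).
  have : (fun h : R => \sum_a (h^-1 *: (phi (h *: v + x) 0 a - phi x 0 a)) *
      Q a (phi (h *: v + x))) @ 0^' -->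
      \sum_a 'D_v (fun t => phi t 0 a) x * partial a f (phi x).
    apply: cvg_sum => a _; apply: cvgM; first exact: dphi.
    exact: (cvg_comp _ _ cphi' (Qc a)).
  apply: cvg_trans; apply: near_eq_cvg.
  apply: (@filterS _ (0 : R)^' _ _ _ _ (cphi' _ Qf)) => h /= ->.
  rewrite scaler_sumr; apply: eq_bigr => a _.
  by rewrite !mxE scalerAl.
split; first by apply/cvg_ex; eexists; exact: D.
exact: cvg_lim D.
Qed.

(** The second difference of [f] over a small square is symmetric in the two directions. It equals
    the area times either mixed derivative, each at some point near [x], and both mixed derivatives
    are continuous at [x]. *)
Lemma partial_symm n (U : set 'rV[R]_n) (f : 'rV[R]_n ->
  R) (x : 'rV[R]_n) i j : open U -> Ck 2 U f -> U x ->
  partial i (partial j f) x = partial j (partial i f) x.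
Proof.
move=> oU Cf Ux.
have /nbhs_rowP[r r0 rU] : nbhs x U by exact: open_nbhs_nbhs.
have near_x k l (a b s : R) : 0 < s -> 0 <= a <= 1 -> 0 <= b <= 1 ->
    `|x + a *: (s *: basis k) + b *: (s *: basis l) - x| <= 2 * s.
  move=> s0 /andP[a0 a1] /andP[b0 b1]; rewrite addrAC [x + _]addrC addrK.
  rewrite (le_trans (ler_normD _ _))// mulr2n mulrDl mul1r.
  suff bound c m : 0 <= c -> c <= 1 -> `|c *: (s *: (basis m : 'rV[R]_n))| <= s.
    by rewrite lerD ?bound.
  move=> c0 c1; rewrite !normrZ (ger0_norm c0) (gtr0_norm s0).
  rewrite (le_trans (ler_piMl _ c1)) ?mulr_ge0 ?(ltW s0)//.
  by rewrite ler_piMr ?(ltW s0)// norm_basis.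
have [cf {}Cf] := Cf.
(* Two mean values: along [k] for the increment [g] of [f] in direction [l], then along [l] for
   [partial k f]. *)
have quotient k l (s : R) : 0 < s -> 2 * s < r ->
    exists2 y, `|y - x| <= 2 * s &
    f (x + s *: basis k + s *: basis l) - f (x + s *: basis k)
    - (f (x + s *: basis l) - f x) = s * s * partial l (partial k f) y.
  move=> s0 sr; pose g y := f (y + s *: basis l) - f y.
  have inU (a b : R) : 0 <= a <= 1 -> 0 <= b <= 1 ->
      U (x + a *: (s *: basis k) + b *: (s *: basis l)).
    move=> a01 b01; apply: rU.
    exact: le_lt_trans (near_x _ _ _ _ _ s0 a01 b01) sr.
  have b0 : 0 <= (0 : R) <= 1 by rewrite lexx ler01.
  have b1 : 0 <= (1 : R) <= 1 by rewrite lexx ler01.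
  have dg (a : R) : 0 <= a <= 1 -> let y := x + a *: (s *: basis k) in
      is_derive y (s *: basis k) g (s * partial k f (y + s *: basis l)
        - s * partial k f y).
    move=> a01 y; apply: is_deriveB.
      have : U (y + s *: basis l) by rewrite -[s *: basis l]scale1r; exact: inU.
      move=> /cf[_ /(_ k) /(is_derive_translate) dt].
      rewrite -[partial k f (y + _)](@derive_val _ _ _ _ _ _ _ dt).
      exact: is_derive_scale (@ex_derive _ _ _ _ _ _ _ dt).
    have : U y by have := inU a 0 a01 b0; rewrite scale0r addr0.
    by move=> /cf[_ /(_ k)]; exact: is_derive_scale.
  have [a a01] := MVT_line (fun a a01 => @ex_derive _ _ _ _ _ _ _ (dg a a01)).
  rewrite (@derive_val _ _ _ _ _ _ _ (dg a a01)) /g => ->.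
  set y := x + _.
  have dk (b : R) : 0 <= b <= 1 ->
      derivable (partial k f) (y + b *: (s *: basis l)) (basis l).
    by move=> b01; exact: ((Cf k).1 _ (inU a b a01 b01)).2.
  have [b b01] := MVT_line (fun b b01 => @ex_derive _ _ _ _ _ _ _
    (is_derive_scale s (dk b b01))).
  rewrite (@derive_val _ _ _ _ _ _ _ (is_derive_scale s (dk b b01))) => E.
  exists (y + b *: (s *: basis l)); first exact: near_x.
  by rewrite -mulrBr E mulrA.
have c2 k l : {for x, continuous (partial k (partial l f))}.
  by have [_ /(_ k)] := Cf l; exact.
apply/eqP; rewrite -subr_eq0 -normr_le0; apply/ler_addgt0Pr => e e0.
rewrite add0r.
have e2 : 0 < e / 2 by rewrite divr_gt0.
have /cvg_rowP/(_ _ e2)[r1 r10 rf1] := c2 i j.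
have /cvg_rowP/(_ _ e2)[r2 r20 rf2] := c2 j i.
pose t := Num.min r (Num.min r1 r2).
have t0 : 0 < t by rewrite !lt_min r0 r10.
(* Intermediate points lie within [2 * s] of [x]; the quarter keeps [2 * s] strictly below all three
   radii. *)
pose s := t / 4.
have s0 : 0 < s by rewrite divr_gt0.
have st : 2 * s < t by rewrite /s; lra.
have [tr [tr1 tr2]] : t <= r /\ t <= r1 /\ t <= r2.
  by rewrite !ge_min !lexx !orbT.
have [y ynear Ey] := quotient j i s s0 (lt_le_trans st tr).
have [y' y'near Ey'] := quotient i j s s0 (lt_le_trans st tr).
have Eyy : partial i (partial j f) y = partial j (partial i f) y'.
  have ss : s * s != 0 by rewrite mulf_neq0 ?gt_eqF.
  apply: (mulfI ss); rewrite -[LHS]Ey -[RHS]Ey'.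
  rewrite [x + s *: basis j + _]addrAC.
  exact: double_difference.
have := rf1 y; have := rf2 y'; rewrite Eyy.
move=> /(_ (le_lt_trans y'near (lt_le_trans st tr2))) h1.
move=> /(_ (le_lt_trans ynear (lt_le_trans st tr1))) h2.
exact: midpoint_bound h1 h2.
Qed.

End Partials.

Section ScalarChain.
Context {R : realType} {V : normedModType R}.
Implicit Types (f : V -> R) (x v : V).

Lemma is_derive_lineP f x v (df : R) :
  is_derive x v f df <-> is_derive (0 : R) 1 (fun h => f (x + h *: v)) df.
Proof.
have E : (fun h : R => f (h *: v + x)) = (fun h => f (x + h *: v)).
  by apply/funext => h; rewrite addrC.
have D : derivable f x v ->
    is_derive (0 : R) 1 (fun h => f (x + h *: v)) ('D_v f x).
  move=> dfx; have dfx0 : derivable f (x + 0 *: v) v by rewrite scale0r addr0.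
  by have := is_derive_line dfx0; rewrite scale0r addr0.
split=> [[dfx <-]|[dl <-]]; first exact: D.
have dfx : derivable f x v by apply/derivable1P; rewrite E.
by split=> //; have [_ <-] := D dfx.
Qed.

Lemma is_derive_comp_real f (g : R -> R) x v (df dg : R) :
  is_derive x v f df -> is_derive (f x) 1 g dg ->
  is_derive x v (fun y => g (f y)) (dg * df).
Proof.
move=> /is_derive_lineP dl dfx; apply/is_derive_lineP.
apply: (@is_derive1_comp _ g (fun h : R => f (x + h *: v))).
by rewrite scale0r addr0.
Qed.

Lemma is_derive_bigsum (I : Type) (r : seq I) (P : pred I) (F : I -> V -> R)
    (dF : I -> R) x v : (forall i, P i -> is_derive x v (F i) (dF i)) ->
  is_derive x v (fun y => \sum_(i <- r | P i) F i y) (\sum_(i <- r | P i) dF i).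
Proof.
move=> FdF; elim: r => [|i r IH].
  have -> : (fun y => \sum_(i <- [::] | P i) F i y) = cst 0.
    by apply/funext => y; rewrite big_nil.
  by rewrite big_nil; exact: is_derive_cst.
rewrite big_cons; case: ifPn => Pi.
  have -> : (fun y => \sum_(j <- i :: r | P j) F j y) =
      F i + (fun y => \sum_(j <- r | P j) F j y).
    by apply/funext => y; rewrite big_cons Pi.
  by apply: is_deriveD; exact: FdF.
have -> : (fun y => \sum_(j <- i :: r | P j) F j y) =
    (fun y => \sum_(j <- r | P j) F j y).
  by apply/funext => y; rewrite big_cons (negbTE Pi).
exact: IH.
Qed.

End ScalarChain.

(** * Closure of C^k under the algebraic operations, [expR] and matrix inversion *)

Section Closure.
Context {R : realType} {n : nat}.
Implicit Types (U : set 'rV[R]_n) (f g : 'rV[R]_n -> R) (x v : 'rV[R]_n).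

Lemma is_derive_coord (a : 'I_n) x v :
  is_derive x v (fun y : 'rV[R]_n => y 0 a) (v 0 a).
Proof.
have did : derivable (id : 'rV[R]_n -> 'rV[R]_n) x v by exact: derivable_id.
have dc := (derivable_mxP _ _ _).1 did.
split; first exact: dc.
by have := derive_mx did; rewrite derive_id => /matrixP/(_ 0 a); rewrite mxE.
Qed.

Lemma partial_coord i a x :
  partial i (fun t : 'rV[R]_n => t 0 a) x = (i == a)%:R.
Proof.
rewrite [LHS](@derive_val _ _ _ _ _ _ _ (is_derive_coord a x (basis i))).
by rewrite mxE eqxx/= eq_sym.
Qed.

Lemma near_eq_on U f g x : open U -> U x -> (forall y, U y -> f y = g y) ->
  \forall y \near x, f y = g y.
Proof.
by move=> oU Ux fg; apply: filterS fg _; exact: open_nbhs_nbhs.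
Qed.

Lemma partial_eq U f g x i : open U -> U x -> (forall y, U y -> f y = g y) ->
  partial i f x = partial i g x.
Proof. by move=> oU Ux fg; apply: near_eq_derive;
  exact: (near_eq_on oU Ux fg). Qed.

Lemma continuous_at_eq U f g x : open U -> U x ->
  (forall y, U y -> f y = g y) -> {for x, continuous f} -> {for x,
    continuous g}.
Proof.
move=> oU Ux fg cf; rewrite /prop_for /continuous_at -(fg _ Ux).
by apply: cvg_trans cf; apply: (near_eq_cvg (F := nbhs x));
  exact: (near_eq_on oU Ux fg).
Qed.

Lemma Ck_eq k U f g : open U -> (forall y, U y -> f y = g y) ->
  Ck k U f -> Ck k U g.
Proof.
move=> oU; elim: k f g => [|k IH] f g fg.
  by move=> cf x Ux; exact: (continuous_at_eq oU Ux fg (cf x Ux)).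
move=> [cf Cf]; split=> [x Ux|i].
  have [cfx dfx] := cf x Ux; split; first exact: (continuous_at_eq oU Ux fg
    cfx).
  by move=> i; apply: near_eq_derivable (dfx i); exact: (near_eq_on oU Ux fg).
by apply: IH (Cf i) => y Uy; exact: (partial_eq _ oU Uy fg).
Qed.

(** The common inductive step of the closure lemmas: it suffices to exhibit a formula for the
    partial derivatives and to know the order of that formula. *)
Lemma CkS_intro k U f (df : 'I_n -> 'rV[R]_n -> R) : open U ->
  (forall x, U x -> {for x, continuous f}) ->
  (forall x i, U x -> is_derive x (basis i) f (df i x)) ->
  (forall i, Ck k U (df i)) -> Ck k.+1 U f.
Proof.
move=> oU cf dfP Cdf; split=> [x Ux|i].
  by split; [exact: cf|move=> i; have [] := dfP x i Ux].
apply: Ck_eq (Cdf i) => // y Uy.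
by rewrite /partial; have [_ ->] := dfP y i Uy.
Qed.

Lemma Ck_is_derive k U f x i : Ck k.+1 U f -> U x ->
  is_derive x (basis i) f (partial i f x).
Proof. by move=> [cf _] Ux; apply: derivableP; exact: (cf x Ux).2. Qed.

Lemma Ck_partial k U f i : Ck k.+1 U f -> Ck k U (partial i f).
Proof. by move=> [_ Cf]; exact: Cf. Qed.

Lemma Ck_cst k U (c : R) : open U -> Ck k U (fun=> c).
Proof.
move=> oU; elim: k c => [|k IH] c; first by move=> x _; exact: cst_continuous.
apply: (@CkS_intro _ _ _ (fun _ _ => 0)) => // x _.
exact: cst_continuous.
Qed.

Lemma Ck_coord k U a : open U -> Ck k U (fun y : 'rV[R]_n => y 0 a).
Proof.
move=> oU; case: k => [|k]; first by move=> x _; exact: coord_continuous.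
apply: (@CkS_intro _ _ _ (fun i _ => (basis i : 'rV[R]_n) 0 a)) => //.
- by move=> x _; exact: coord_continuous.
- by move=> x i _; exact: is_derive_coord.
- by move=> i; exact: Ck_cst.
Qed.

Lemma Ck_add k U f g : open U ->
  Ck k U f -> Ck k U g -> Ck k U (fun x => f x + g x).
Proof.
move=> oU; elim: k f g => [|k IH] f g Cf Cg.
  by move=> x Ux; apply: continuousD; [exact: (Cf x Ux)|exact: (Cg x Ux)].
apply: (@CkS_intro _ _ _ (fun i x => partial i f x + partial i g x)) => //.
- by move=> x Ux; apply: continuousD; [exact: (Ck_continuous Cf)|exact:
  (Ck_continuous Cg)].
- move=> x i Ux; apply: is_deriveD; first exact: (Ck_is_derive i Cf Ux).
  exact: (Ck_is_derive i Cg Ux).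
- by move=> i; apply: IH; exact: Ck_partial.
Qed.

Lemma Ck_mul k U f g : open U ->
  Ck k U f -> Ck k U g -> Ck k U (fun x => f x * g x).
Proof.
move=> oU; elim: k f g => [|k IH] f g Cf Cg.
  by move=> x Ux; apply: continuousM; [exact: (Cf x Ux)|exact: (Cg x Ux)].
apply: (@CkS_intro _ _ _
  (fun i x => f x * partial i g x + g x * partial i f x)) => //.
- by move=> x Ux; apply: continuousM; [exact: (Ck_continuous Cf)|exact:
  (Ck_continuous Cg)].
- move=> x i Ux; apply: is_deriveM; first exact: (Ck_is_derive i Cf Ux).
  exact: (Ck_is_derive i Cg Ux).
- by move=> i; apply: Ck_add => //; apply: IH;
     try exact: CkS; exact: Ck_partial.
Qed.

Lemma Ck_opp k U f : open U -> Ck k U f -> Ck k U (fun x => - f x).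
Proof.
move=> oU Cf; apply: (@Ck_eq _ _ (fun x => -1 * f x)) => //.
  by move=> y _; rewrite mulN1r.
by apply: Ck_mul => //; exact: Ck_cst.
Qed.

Lemma Ck_sub k U f g : open U ->
  Ck k U f -> Ck k U g -> Ck k U (fun x => f x - g x).
Proof. by move=> oU Cf Cg; apply: Ck_add => //; exact: Ck_opp. Qed.

Lemma Ck_sum k U (I : Type) (r : seq I) (P : pred I) (F : I -> 'rV[R]_n -> R) :
  open U -> (forall i, P i -> Ck k U (F i)) ->
  Ck k U (fun x => \sum_(i <- r | P i) F i x).
Proof.
move=> oU CF; elim: r => [|i r IH].
  by apply: (@Ck_eq _ _ (fun=> 0)) (Ck_cst _ _ oU) => // y _; rewrite big_nil.
have [Pi|Pi] := boolP (P i); last first.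
  by apply: Ck_eq IH => // y _; rewrite big_cons (negbTE Pi).
apply: Ck_eq (Ck_add oU (CF i Pi) IH) => // y _.
by rewrite big_cons Pi.
Qed.

Lemma Ck_prod k U (I : Type) (r : seq I) (P : pred I) (F : I -> 'rV[R]_n -> R) :
  open U -> (forall i, P i -> Ck k U (F i)) ->
  Ck k U (fun x => \prod_(i <- r | P i) F i x).
Proof.
move=> oU CF; elim: r => [|i r IH].
  by apply: (@Ck_eq _ _ (fun=> 1)) (Ck_cst _ _ oU) => // y _; rewrite big_nil.
have [Pi|Pi] := boolP (P i); last first.
  by apply: Ck_eq IH => // y _; rewrite big_cons (negbTE Pi).
apply: Ck_eq (Ck_mul oU (CF i Pi) IH) => // y _.
by rewrite big_cons Pi.
Qed.

Lemma Ck_exp k U f : open U -> Ck k U f -> Ck k U (fun x => expR (f x)).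
Proof.
have cexp x : {for x, continuous f} -> {for x, continuous (fun x =>
  expR (f x))}.
  by move=> cf; apply: continuous_comp cf _; exact: continuous_expR.
move=> oU; elim: k => [|k IH] Cf; first by move=> x Ux; apply: cexp;
  exact: (Cf x Ux).
apply: (@CkS_intro _ _ _ (fun i x => expR (f x) * partial i f x)) => //.
- by move=> x Ux; apply: cexp; exact: (Ck_continuous Cf).
- by move=> x i Ux; apply: is_derive_comp_real; exact: (Ck_is_derive i Cf Ux).
- by move=> i; apply: Ck_mul => //; [apply: IH; exact: CkS|exact: Ck_partial].
Qed.

Lemma Ck_inv k U f : open U -> (forall x, U x -> f x != 0) ->
  Ck k U f -> Ck k U (fun x => (f x)^-1).
Proof.
move=> oU f0; elim: k => [|k IH] Cf.
  by move=> x Ux; apply: continuousV; [exact: f0|exact: (Cf x Ux)].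
apply: (@CkS_intro _ _ _ (fun i x => - ((f x)^-1 * (f x)^-1 * partial i f x)))
  => //.
- by move=> x Ux; apply: continuousV; [exact: f0|exact: (Ck_continuous Cf)].
- move=> x i Ux; have [dfx _] := Ck_is_derive i Cf Ux.
  split; first by apply: derivableV => //; exact: f0.
  rewrite deriveV//; last exact: f0.
  by rewrite -mulNr expr2 invfM.
- by move=> i; apply: Ck_opp => //; apply: Ck_mul => //;
     [apply: Ck_mul => //; apply: IH; exact: CkS|exact: Ck_partial].
Qed.

Lemma Ck_det k U m (A : 'rV[R]_n -> 'M[R]_m) : open U ->
  (forall i j, Ck k U (fun x => A x i j)) -> Ck k U (fun x => \det (A x)).
Proof.
move=> oU CA; apply: Ck_sum => // s _; apply: Ck_mul => //; first exact: Ck_cst.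
by apply: Ck_prod.
Qed.

Lemma Ck_adj k U m (A : 'rV[R]_n -> 'M[R]_m) i j : open U ->
  (forall i j, Ck k U (fun x => A x i j)) -> Ck k U (fun x => (\adj (A x)) i j).
Proof.
move=> oU CA; apply: (@Ck_eq _ _ (fun x => cofactor (A x) j i)) => //.
  by move=> y _; rewrite mxE.
apply: Ck_mul => //; first exact: Ck_cst.
apply: Ck_det => // i' j'; apply: Ck_eq (CA (lift j i') (lift i j')) => // y _.
by rewrite !mxE.
Qed.

Lemma Ck_invmx k U m (A : 'rV[R]_n -> 'M[R]_m) i j : open U ->
  (forall x, U x -> A x \in unitmx) ->
  (forall i j, Ck k U (fun x => A x i j)) -> Ck k U (fun x =>
    (invmx (A x)) i j).
Proof.
move=> oU uA CA.
apply: (@Ck_eq _ _ (fun x => (\det (A x))^-1 * (\adj (A x)) i j)) => //.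
  by move=> y Uy; rewrite /invmx (uA y Uy) [RHS]mxE.
apply: Ck_mul => //; last exact: Ck_adj.
apply: Ck_inv => //; last exact: Ck_det.
by move=> x Ux; rewrite -unitfE -unitmxE; exact: uA.
Qed.

End Closure.

Lemma Ck_comp (R : realType) n m k (U : set 'rV[R]_n) (V : set 'rV[R]_m)
    (f : 'rV[R]_m -> R) (phi : 'rV[R]_n -> 'rV[R]_m) :
  open U -> open V -> (forall x, U x -> V (phi x)) ->
  Ck k V f -> (forall a, Ck k U (fun x => phi x 0 a)) ->
  Ck k U (fun x => f (phi x)).
Proof.
move=> oU oV UV; elim: k f => [|k IH] f Cf Cphi.
  move=> x Ux; apply: (cvg_comp phi f _ (Cf _ (UV _ Ux))).
  by apply: (cvg_row (F := nbhs x)) => a; exact: Cphi.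
have cf x : U x -> {for x, continuous (fun x => f (phi x))}.
  move=> Ux; apply: (cvg_comp phi f _ (Ck_continuous Cf (UV _ Ux))).
  by apply: (cvg_row (F := nbhs x)) => a; exact: (Ck_continuous (Cphi a)).
apply: (@CkS_intro _ _ _ _ _ (fun i x =>
  \sum_a partial i (fun y => phi y 0 a) x * partial a f (phi x))) => //.
- move=> x i Ux; apply: (is_derive_comp_row oV (Ck1 Cf) (UV _ Ux)) => a.
  by have [] := Ck_is_derive i (Cphi a) Ux.
- move=> i; apply: Ck_sum => // a _; apply: Ck_mul => //.
    exact: (Ck_partial _ (Cphi a)).
  by apply: IH => [|b]; [exact: Ck_partial|exact: CkS].
Qed.

(** * Inverse function theorem *)

Section InverseFunction.
Context {R : realType} {n : nat}.
Implicit Types (x y : 'rV[R]_n).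

(** Rows index the direction of differentiation. This is the transpose of the usual Jacobian: it
    acts on row vectors from the right, and composites multiply in the order of application. *)
Definition jacobian_mx m (f : 'rV[R]_n -> 'rV[R]_m) x : 'M[R]_(n, m) :=
  \matrix_(i, l) partial i (fun y => f y 0 l) x.

Variable f : 'rV[R]_n -> 'rV[R]_n.
Hypothesis smooth_f : smooth_map_on setT f.
Hypothesis inj_f : injective f.
Hypothesis unit_f : forall x, jacobian_mx f x \in unitmx.

Let Cf k l : Ck k setT (fun x => f x 0 l).
Proof. by have /smooth_onP := smooth_f l; exact. Qed.

(** The sup norm of row vectors is not differentiable, so the minimisation below uses the squared
    Euclidean distance. *)
Let dist y x := \sum_l (f x 0 l - y 0 l) ^+ 2.

Let Cdist k y : Ck k setT (dist y).
Proof.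
apply: Ck_sum => [|l _]; first exact: openT.
have Cl : Ck k setT (fun x => f x 0 l - y 0 l).
  by apply: Ck_sub (Cf k l) _; [exact: openT|exact: (Ck_cst _ _ openT)].
by apply: Ck_eq (Ck_mul openT Cl Cl); [exact: openT|move=> x _; rewrite expr2].
Qed.

Let continuous_dist y : continuous (dist y).
Proof. by move=> x; exact: (Cdist 0 y). Qed.

Let dist_ge0 y x : 0 <= dist y x.
Proof. by apply: sumr_ge0 => l _; exact: sqr_ge0. Qed.

Let dist_eq0 y x : dist y x = 0 -> f x = y.
Proof.
move=> /eqP; rewrite psumr_eq0 => [/allP d0|l _]; last exact: sqr_ge0.
apply/rowP => l; apply/eqP; rewrite -subr_eq0 -sqrf_eq0.
exact: d0 (mem_index_enum l).
Qed.

(** Without square roots the triangle inequality costs a factor 2; the gap is the square of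
    [a + b - 2 * c] in each coordinate. *)
Let dist_triangle y x x0 : dist (f x0) x <= 2 * dist y x + 2 * dist y x0.
Proof.
rewrite !mulr_sumr -big_split/=; apply: ler_sum => l _.
move: (f x 0 l) (f x0 0 l) (y 0 l) => a b c; rewrite -subr_ge0.
have -> : 2 * (a - c) ^+ 2 + 2 * (b - c) ^+ 2 - (a - b) ^+ 2 =
  (a + b - 2 * c) ^+ 2 by ring.
exact: sqr_ge0.
Qed.

(** The gradient of [dist y] at [x] is twice [f x - y] times the transposed Jacobian, which is
    invertible. *)
Let critical y x : (forall i, partial i (dist y) x = 0) -> f x = y.
Proof.
move=> dx0.
have dE i : partial i (dist y) x =
    \sum_l 2 * (f x 0 l - y 0 l) * jacobian_mx f x i l.
  apply: (@derive_val _ _ _ x (basis i)).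
  have := @is_derive_sum R 'rV[R]_n R n (fun l x => (f x 0 l - y 0 l) ^+ 2) x
    (basis i) (fun l => 2 * (f x 0 l - y 0 l) * jacobian_mx f x i l).
  have -> : \sum_(l < n) (fun x => (f x 0 l - y 0 l) ^+ 2) = dist y.
    by apply/funext => z; rewrite /dist fct_sumE.
  apply => l; have dl := Ck_is_derive i (Cf 1 l) (I : setT x).
  have dy : is_derive x (basis i) (fun=> y 0 l : R) 0 by exact: is_derive_cst.
  have := is_deriveX 2 (is_deriveB dl dy).
  rewrite subr0 mxE expr1; exact.
have : (f x - y) *m (jacobian_mx f x)^T = 0.
  apply/rowP => i; rewrite !mxE; apply: (@mulfI _ (2 : R));
    first by rewrite pnatr_eq0.
  rewrite mulr0 -[RHS](dx0 i) dE mulr_sumr; apply: eq_bigr => l _.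
  by rewrite !mxE mulrA.
move=> /(congr1 (mulmx^~ (invmx (jacobian_mx f x)^T))).
rewrite mulmxK ?unitmx_tr// mul0mx => /eqP; rewrite subr_eq0 => /eqP.
exact.
Qed.

Let bounded_ball x0 r : bounded_set [set x | `|x - x0| <= r].
Proof.
exists (r + `|x0|); split; first exact: num_real.
move=> M rM x /= xr; rewrite (le_trans _ (ltW rM))//.
by rewrite -[x](subrK x0) (le_trans (ler_normD _ _))// lerD2r.
Qed.

Let continuous_distance x0 : continuous (fun x => `|x - x0|).
Proof.
move=> x; apply: (continuous_comp (f := fun x => x - x0));
  last exact: norm_continuous.
by apply: continuousD; [exact: id|exact: cst_continuous].
Qed.

Let compact_cball x0 r : compact [set x | `|x - x0| <= r].
Proof.
apply: bounded_closed_compact; first exact: bounded_ball.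
apply: (@closed_comp _ _ (fun x => `|x - x0|) [set s | s <= r]).
  by move=> x _; exact: continuous_distance.
exact: closed_le.
Qed.

Let compact_sphere x0 r : compact [set x | `|x - x0| = r].
Proof.
apply: bounded_closed_compact.
  have [M [Mr MB]] := @bounded_ball x0 r; exists M; split=> // N /MB NB x xr.
  by apply: NB; rewrite /= xr.
apply: (@closed_comp _ _ (fun x => `|x - x0|) [set s | s = r]).
  by move=> x _; exact: continuous_distance.
exact: closed_eq.
Qed.

(* The minimiser of |f x - y|^2 over a closed ball is interior for y close to
   f x0, hence critical, and the only critical value is 0. *)
Lemma locally_onto x0 r : 0 < r -> exists2 d, 0 < d &
  forall y, `|y - f x0| < d -> exists2 x, `|x - x0| < r & f x = y.
Proof.
move=> r0.
(* [m] is the minimum over the sphere, positive because [f] is injective. The sphere is empty when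
   [n = 0], and then any positive value serves. *)
have [m m0 mS] : exists2 m, 0 < m & forall x, `|x - x0| = r ->
  m <= dist (f x0) x.
  have [[z zr]|noS] := pselect (exists z, `|z - x0| = r); last first.
    by exists 1 => // x xr; exfalso; apply: noS; exists x.
  have [c cS cmin] := compact_EVT_min (ex_intro _ z zr) (@compact_sphere x0 r)
    (continuous_subspaceT (@continuous_dist (f x0))).
  exists (dist (f x0) c) => [|x xr]; last by apply: cmin; rewrite inE.
  rewrite lt_neqAle dist_ge0 andbT eq_sym; apply/eqP => /dist_eq0/inj_f cx0.
  by move: cS r0; rewrite inE/= cx0 subrr normr0 => <-; rewrite ltxx.
(* The quarter is what [dist_triangle] demands: a minimiser on the sphere would give [m <= 2 * dist
   y c + 2 * dist y x0 <= 4 * dist y x0 < m]. *)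
have [d d0 dP] : exists2 d, 0 < d & forall y, `|y - f x0| < d ->
  dist y x0 < m / 4.
  have c : continuous (fun y : 'rV[R]_n => \sum_l (f x0 0 l - y 0 l) ^+ 2).
    move=> y; apply: (@Ck_continuous _ _ 0 setT) => //.
    apply: Ck_sum => [|l _]; first exact: openT.
    have Cl : Ck 0 setT (fun y : 'rV[R]_n => f x0 0 l - y 0 l).
      by apply: Ck_sub; [exact: openT|exact: (Ck_cst _ _ openT)|
                         exact: (Ck_coord _ _ openT)].
    by apply: Ck_eq (Ck_mul openT Cl Cl); [exact: openT|move=> z _;
      rewrite expr2].
  have m4 : 0 < m / 4 by rewrite divr_gt0.
  have /cvg_rowP/(_ _ m4)[d d0 dP] := c (f x0).
  exists d => // y /dP; rewrite [X in _ - X]big1 => [|l _];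
    last by rewrite subrr expr0n.
  by rewrite subr0 => /(le_lt_trans (ler_norm _)).
exists d => // y /dP yd.
have x0B : [set x | `|x - x0| <= r] x0 by rewrite /= subrr normr0 ltW.
have [c cB cmin] := compact_EVT_min (ex_intro _ x0 x0B) (@compact_cball x0 r)
  (continuous_subspaceT (@continuous_dist y)).
have cx0 : dist y c <= dist y x0 by apply: cmin; rewrite inE/= subrr normr0 ltW.
have cr : `|c - x0| < r.
  move: cB; rewrite inE/= le_eqVlt => /orP[/eqP cr|//].
  have := mS c cr; have := dist_triangle y c x0.
  by move: (dist _ _) (dist _ _) (dist _ _) cx0 yd => A B C *; lra.
exists c => //; apply: critical => i.
(* [rho] is the room left between [c] and the sphere, so small moves of [c] along an axis stay in
   the ball and the one-variable criterion for a minimum applies. *)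
pose rho := r - `|c - x0|.
have rho0 : 0 < rho by rewrite subr_gt0.
pose h (s : R) := dist y (c + s *: basis i).
have dh (s : R) : derivable h s 1.
  have [+ _] := Ck_is_derive i (Cdist 1 y) (I : setT (c + s *: basis i)).
  by move=> /is_derive_line[].
have h0 : is_derive (0 : R) 1 h 0.
  apply: (@derive1_at_min R h (- rho) rho 0) => //.
  - by rewrite ge0_cp// ltW.
  - by rewrite in_itv/= oppr_lt0 rho0.
  - move=> s; rewrite in_itv/= => srho; rewrite /h scale0r addr0.
    apply: cmin; rewrite inE/= addrAC (le_trans (ler_normD _ _))//.
    rewrite -lerBrDl -/rho normrZ (le_trans (ler_piMr _ (norm_basis _)))//.
    by rewrite ler_norml; case/andP: srho => /ltW -> /ltW.
have dc := (is_derive_lineP (dist y) c (basis i) 0).2 h0.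
exact: (@derive_val _ _ _ _ _ _ _ dc).
Qed.

Variable g : 'rV[R]_n -> 'rV[R]_n.
Hypothesis fK : cancel f g.

Lemma open_range_inj : open (range f).
Proof.
rewrite openE => _ [x0 _ <-]; apply/nbhs_rowP.
have [d d0 dP] := @locally_onto x0 1 ltr01.
by exists d => // y /dP[x _ <-]; exists x.
Qed.

Lemma inverse_cvg x0 l : (fun y => g y 0 l) @ f x0 --> x0 0 l.
Proof.
apply/cvg_rowP => e e0; have [d d0 dP] := locally_onto x0 e0.
exists d => // y /dP[x xe <-]; rewrite fK; apply: le_lt_trans xe.
by have := coord_le_norm (x - x0) l; rewrite !mxE.
Qed.

(** Let [q x] be the matrix of slopes, with [f x - f x0 = (x - x0) *m q x] and [q x] tending to the
    Jacobian. Along [f x0 + h *: basis j] this reads [h *: basis j = (g (line h) - x0) *m q (g (line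
    h))], so the difference quotient of [g] is row [j] of the inverse of [q]. Only continuity of [g]
    is needed to pass to the limit. *)
Lemma inverse_is_derive x0 j l : is_derive (f x0) (basis j)
  (fun y => g y 0 l) (invmx (jacobian_mx f x0) j l).
Proof.
set J := jacobian_mx f x0.
have [Q QP] := choice (fun l =>
  C1_slopes openT (Cf 1 l) (I : setT x0)).
pose q x : 'M[R]_n := \matrix_(i, l) Q l i x.
have gc : g @ f x0 --> x0.
  by apply: (cvg_row (F := nbhs (f x0))) => a; exact: inverse_cvg.
pose line (h : R) := f x0 + h *: (basis j : 'rV[R]_n).
have lc : line @ (0 : R)^' --> f x0.
  apply: (@cvg_within_filter _ _ _ (nbhs (0 : R))).
  apply: (cvg_row (F := nbhs (0 : R))) => a.
  have -> : (fun h => line h 0 a) =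
      (fun h => (fun y : 'rV[R]_n => y 0 a) (h *: basis j + f x0)).
    by apply/funext => h; rewrite /line addrC.
  apply: (@continuous_along _ _ (fun y : 'rV[R]_n => y 0 a)).
  by have [] := is_derive_coord a (f x0) (basis j).
have glc : (g \o line) @ (0 : R)^' --> x0 by exact: (cvg_comp _ _ lc gc).
have qc i k : (fun h => q (g (line h)) i k) @ (0 : R)^' --> J i k.
  rewrite mxE; under eq_fun do rewrite mxE.
  exact: (cvg_comp _ _ glc ((QP k).1 i)).
have lim : (fun h => (\det (q (g (line h))))^-1 * (\adj (q (g (line h)))) j l)
    @ (0 : R)^' --> invmx J j l by exact (@cvg_invmx R _ _ _ n (fun h =>
      q (g (line h))) J j l (unit_f x0) qc).
have slope : \forall h \near (0 : R)^',
    forall k, f (g (line h)) 0 k - f x0 0 k =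
      \sum_i (g (line h) - x0) 0 i * Q k i (g (line h)).
  apply: filter_forall => k.
  exact: (glc _ (QP k).2).
have inr : \forall h \near (0 : R)^', f (g (line h)) = line h.
  have : nbhs (f x0) (range f).
    by apply: open_nbhs_nbhs; split; [exact: open_range_inj|exists x0].
  by move=> /lc; apply: (@filterS _ (0 : R)^') => h [x _ <-]; rewrite fK.
have detn0 : \forall h \near (0 : R)^', \det (q (g (line h))) != 0.
  have dc : (fun h => \det (q (g (line h)))) @ (0 : R)^' -->
    \det J by exact: cvg_det.
  have J0 : \det J != 0 by rewrite -unitfE -unitmxE unit_f.
  by apply: cvgr_neq0 J0; exact: dc.
have D : (fun h : R => h^-1 *: (((fun y => g y 0 l) \o shift (f x0))
    (h *: basis j) - g (f x0) 0 l)) @ 0^' --> invmx J j l.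
  apply: cvg_trans lim; apply: (near_eq_cvg (F := (0 : R)^')).
  near=> h.
  have h0 : h != 0 by near: h; exact: nbhs_dnbhs_neq.
  have E1 : f (g (line h)) = line h by near: h.
  have E2 : forall k, f (g (line h)) 0 k - f x0 0 k =
      \sum_i (g (line h) - x0) 0 i * Q k i (g (line h)) by near: h.
  have E3 : \det (q (g (line h))) != 0 by near: h.
  have uq : q (g (line h)) \in unitmx by rewrite unitmxE unitfE.
  have E4 : h *: basis j = (g (line h) - x0) *m q (g (line h)).
    apply/rowP => k; have := E2 k; rewrite E1 [line h]lock !mxE -lock.
    rewrite /line !mxE addrAC subrr add0r => ->.
    by apply: eq_bigr => i _; rewrite !mxE.
  rewrite /= fK [h *: _ + _]addrC -/(line h).
  have -> : g (line h) 0 l - x0 0 l = (g (line h) - x0) 0 l by rewrite !mxE.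
  rewrite -[g (line h) - x0](mulmxK uq) -E4 -scalemxAl [X in _ = _ *: X]mxE
    [RHS](mulKf h0).
  by rewrite /invmx uq -rowE !mxE.
split; first by apply/cvg_ex; eexists; exact: D.
exact: cvg_lim D.
Unshelve. all: by end_near. Qed.

(** Bootstrapping: the derivative of [g] is the inverse Jacobian of [f] taken at [g y], which has
    the order already known for [g]; so [g] gains one order at each round. *)
Lemma smooth_inverse : smooth_map_on (range f) g.
Proof.
have oR := open_range_inj.
move=> l; apply/smooth_onP => k; elim: k l => [|k IH] l.
  move=> _ [x0 _ <-]; rewrite /prop_for /continuous_at fK.
  exact: inverse_cvg.
apply: (@CkS_intro _ _ _ _ _ (fun j y => invmx (jacobian_mx f (g y)) j l)) =>
  //.
- by move=> y Ry; exact: (Ck_continuous (IH l)).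
- by move=> _ j [x0 _ <-]; rewrite fK; exact: inverse_is_derive.
- move=> j; apply: (Ck_invmx (A := fun y => jacobian_mx f (g y))) => //.
  move=> i a; apply: (@Ck_eq _ _ _ _
    (fun y => partial i (fun x => f x 0 a) (g y))) => //.
    by move=> y _; rewrite mxE.
  by apply: (Ck_comp oR openT) => //; exact: (Ck_partial _ (Cf k.+1 a)).
Qed.

End InverseFunction.

Lemma inverse_function_theorem (R : realType) n (f : 'rV[R]_n -> 'rV[R]_n) :
  smooth_map_on setT f -> injective f ->
  (forall x, jacobian_mx f x \in unitmx) ->
  exists g, [/\ cancel f g, open (range f) & smooth_map_on (range f) g].
Proof.
move=> sf fI uf; pose g y := xget 0 [set x | f x = y].
have fK : cancel f g.
  by move=> x; apply: fI; have := @xgetPex _ 0 [set z | f z = f x]; apply;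
    exists x.
by exists g; split => //; [exact: open_range_inj|exact: smooth_inverse].
Qed.

(** * Stationary distributions *)

Section MarkovKernelFacts.
Context {R : realType} {X : finType} (E : rel X).
Hypothesis connE : strongly_connected E.

(** Irreducibility as induction along edges; it spreads maxima of potentials and positivity of the
    stationary distribution to all states. *)
Lemma edge_closed_all (P : pred X) :
  (forall x y, P x -> E x y -> P y) -> forall x y, P x -> P y.
Proof.
move=> PE x y Px; have [s [_ sE <-]] := connE x y.
by elim: s x Px sE => //= z s IH x Px /andP[xz zs]; exact: IH (PE _ _ Px xz) zs.
Qed.

Lemma out_neighbor x : exists y, E x y.
Proof. by have [[|y s] [//= _ /andP[xy _] _]] := connE x x; exists y. Qed.

(** At a maximum [x] of [h] a positive [c] would make every term over the out-neighbours of [x]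
    negative, and there is at least one. *)
Let rigidity_le (T : X -> X -> R -> R) (h : X -> R) (c : R) :
  (forall x y s, E x y -> Num.sg (T x y s) = Num.sg s) ->
  (forall x, \sum_(y | E x y) T x y (h y - h x - c) = 0) -> X -> c <= 0.
Proof.
move=> sgT T0 x0; rewrite leNgt; apply/negP => c0.
pose x := [arg max_(i > x0) h i]%O.
have hx y : h y <= h x.
  by rewrite /x; case: arg_maxP => // i _ /(_ y); apply.
have neg y : E x y -> T x y (h y - h x - c) < 0.
  move=> xy; rewrite -sgr_lt0 sgT// sgr_lt0.
  by rewrite subr_lt0 (le_lt_trans _ c0)// subr_le0.
have [z xz] := out_neighbor x.
have := T0 x; apply/eqP; rewrite lt_eqF// (bigD1 z)//=.
rewrite -[ltRHS]addr0; apply: ltr_leD; first exact: neg.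
by apply: sumr_le0 => y /andP[xy _]; rewrite ltW ?neg.
Qed.

(* A discrete maximum principle covering both the linearised and the
   exponential normalisation equations of a kernel. *)
Lemma rigidity (T : X -> X -> R -> R) (h : X -> R) (c : R) :
  (forall x y s, E x y -> Num.sg (T x y s) = Num.sg s) ->
  (forall x, \sum_(y | E x y) T x y (h y - h x - c) = 0) -> X ->
  c = 0 /\ forall x y, h x = h y.
Proof.
move=> sgT T0 x0.
have c0 : c = 0.
  apply/le_anti; rewrite (rigidity_le sgT T0 x0) -oppr_le0.
  (* Reflecting [h], [c] and the argument of [T] preserves the sign condition and yields the
     opposite inequality. *)
  apply: (@rigidity_le (fun x y s => - T x y (- s)) (fun x => - h x)) => //.
    by move=> x y s xy; rewrite sgrN sgT// sgrN opprK.
  move=> x; rewrite sumrN -[RHS]oppr0; congr (- _); rewrite -[RHS](T0 x).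
  by apply: eq_bigr => y _; congr T; ring.
split=> //.
pose x1 := [arg max_(i > x0) h i]%O.
have hx y : h y <= h x1.
  by rewrite /x1; case: arg_maxP => // i _ /(_ y); apply.
suff all1 y : h y == h x1 by move=> x y; rewrite (eqP (all1 x)) (eqP (all1 y)).
(* With [c = 0] no term at a maximum is positive, so a zero sum kills each of them and every
   out-neighbour is again a maximum. *)
apply: (@edge_closed_all (fun y => h y == h x1)) (eqxx (h x1)) =>
  x {}y /eqP hxe xy.
have sg_term z : E x z -> Num.sg (T x z (h z - h x - c)) = Num.sg (h z - h x1).
  by move=> xz; rewrite sgT// c0 subr0 hxe.
have := T0 x; move/eqP; rewrite -oppr_eq0 -sumrN psumr_eq0 => [|z xz];
  last first.
  by rewrite oppr_ge0 -sgr_le0 sg_term// sgr_le0 subr_le0.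
move=> /allP/(_ y (mem_index_enum y)); rewrite xy/= oppr_eq0 -sgr_eq0 sg_term//.
by rewrite sgr_eq0 subr_eq0.
Qed.

Implicit Types (w : X -> X -> R) (p : {ffun X -> R}).

Lemma kernel_on_out w x y : kernel_on E w -> ~~ E x y -> w x y = 0.
Proof.
move=> [[w01 _] wE] nE; apply/le_anti.
have /andP[-> _] := w01 x y.
by rewrite andbT leNgt wE.
Qed.

Lemma kernel_on_gt0 w x y : kernel_on E w -> E x y -> 0 < w x y.
Proof. by move=> [_ wE]; rewrite -wE. Qed.

Lemma kernel_on_sum w x : kernel_on E w -> \sum_(y | E x y) w x y = 1.
Proof.
move=> wE; have [[_ w1] _] := wE; rewrite -[RHS](w1 x) [RHS](bigID (E x))/=.
by rewrite [X in _ + X]big1 ?addr0// => y; exact: kernel_on_out.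
Qed.

(* A row vector p is the stationary distribution exactly when p A = (1, .., 1)
   for A = 1 - w + J, J being the all-ones matrix. *)
Definition balance_mx w : 'M[R]_#|X| :=
  \matrix_(i, j) ((i == j)%:R - w (enum_val i) (enum_val j) + 1).

Definition balance_solution w : 'rV[R]_#|X| :=
  const_mx 1 *m invmx (balance_mx w).

Lemma sum_ord_enum (f : X -> R) : \sum_(i < #|X|) f (enum_val i) = \sum_x f x.
Proof. by rewrite [RHS](reindex _ (onW_bij _ (@enum_val_bij X))). Qed.

Lemma balance_mxE w (q : 'rV[R]_#|X|) j : (q *m balance_mx w) 0 j =
  q 0 j - \sum_i q 0 i * w (enum_val i) (enum_val j) + \sum_i q 0 i.
Proof.
rewrite mxE; under eq_bigr do rewrite mxE mulrDr mulrBr mulr1.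
rewrite big_split sumrB/=; congr (_ - _ + _).
rewrite (bigD1 j)//= eqxx mulr1 big1 ?addr0// => i /negbTE ->.
by rewrite mulr0.
Qed.

(** The transpose is used because the maximum principle concerns functions, that is column vectors.
    A null vector [h] satisfies the hypothesis of [rigidity] with [c] the sum of [h]; hence [h] is
    constant with sum 0. *)
Lemma balance_mx_unit w : kernel_on E w -> balance_mx w \in unitmx.
Proof.
move=> wE; rewrite -unitmx_tr -row_free_unit; apply/inj_row_free => v vA.
pose h x := v 0 (enum_rank x); pose c := \sum_x h x.
have hE i : h (enum_val i) = v 0 i by rewrite /h enum_valK.
have eqn x : \sum_(y | E x y) w x y * (h y - h x - c) = 0.
  have /rowP/(_ (enum_rank x)) := vA; rewrite !mxE.
  under eq_bigr do rewrite !mxE -hE.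
  rewrite (eq_bigr (fun i => h (enum_val i) * (enum_rank x == i)%:R
    - w x (enum_val i) * h (enum_val i) + h (enum_val i))); last first.
    by move=> i _; rewrite enum_rankK mulrDr mulrBr mulr1 [_ * w _ _]mulrC.
  rewrite big_split sumrB/= (sum_ord_enum h) -/c.
  rewrite (sum_ord_enum (fun y => w x y * h y)).
  rewrite (bigD1 (enum_rank x))//= eqxx mulr1 enum_rankK big1 ?addr0;
    last first.
    by move=> i; rewrite eq_sym => /negbTE ->; rewrite mulr0.
  move=> eq0; transitivity (\sum_(y | E x y) w x y * h y - h x - c).
    under eq_bigr do rewrite !mulrBr.
    by rewrite !sumrB -!mulr_suml kernel_on_sum// !mul1r.
  have sumE : \sum_y w x y * h y = \sum_(y | E x y) w x y * h y.
    rewrite (bigID (E x))/= [X in _ + X]big1 ?addr0// => y nE.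
    by rewrite (kernel_on_out wE nE) mul0r.
  rewrite -sumE; apply: oppr_inj; rewrite oppr0 -[RHS]eq0.
  by ring.
apply/rowP => i; rewrite mxE -hE; set x := enum_val i.
have [|c0 hc] := rigidity (T := fun x y s => w x y * s) _ eqn x.
  by move=> a b s /(kernel_on_gt0 wE) w0; rewrite sgrM (gtr0_sg w0) mul1r.
have : \sum_(y : X) h x = 0.
  by rewrite -[RHS]c0; apply: eq_bigr => y _; exact: hc.
rewrite sumr_const => /eqP; rewrite mulrn_eq0 => /orP[/eqP|/eqP//].
by move=> X0; have := fintype0 x X0.
Qed.

Lemma is_stationary_unique w p : kernel_on E w -> is_stationary w p ->
  forall x, p x = balance_solution w 0 (enum_rank x).
Proof.
move=> wE [_ p1 pw] x.
pose q : 'rV[R]_#|X| := \row_j p (enum_val j).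
have qA : q *m balance_mx w = const_mx 1.
  apply/rowP => j; rewrite balance_mxE !mxE.
  under eq_bigr do rewrite mxE.
  rewrite (sum_ord_enum (fun x => p x * w x (enum_val j))) pw subrr add0r.
  by under eq_bigr do rewrite mxE; rewrite sum_ord_enum.
rewrite /balance_solution -qA mulmxK ?balance_mx_unit//.
by rewrite mxE enum_rankK.
Qed.

(** Summing the equations over [y] shows that [Q] has total mass 1, hence is invariant. For
    positivity, [|Q|] is at most its image under [w] pointwise and both have the same total, so
    [|Q|] is invariant too. Normalised, it is stationary and equals [Q] by uniqueness. *)
Lemma balance_solution_stationary w : kernel_on E w -> X ->
  is_stationary w [ffun x => balance_solution w 0 (enum_rank x)].
Proof.
move=> wE x0; set q := balance_solution w.
pose Q x := q 0 (enum_rank x).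
have QE i : Q (enum_val i) = q 0 i by rewrite /Q enum_valK.
have w1 x : \sum_y w x y = 1 by have [[_ w1] _] := wE.
have w0 x y : 0 <= w x y by have [[/(_ x y)/andP[]]] := wE.
have qA y : Q y - \sum_x Q x * w x y + \sum_x Q x = 1.
  have : q *m balance_mx w = const_mx 1 by rewrite mulmxKV ?balance_mx_unit.
  move=> /rowP/(_ (enum_rank y)); rewrite balance_mxE [X in _ = X]mxE => <-.
  congr (_ - _ + _).
    rewrite -[LHS](sum_ord_enum (fun x => Q x * w x y)).
    by apply: eq_bigr => i _; rewrite QE enum_rankK.
  by rewrite -[LHS](sum_ord_enum Q); apply: eq_bigr => i _; rewrite QE.
have cardX0 : #|X|%:R != 0 :> R.
  by rewrite pnatr_eq0 -lt0n; apply/card_gt0P; exists x0.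
have exchange (f : X -> R) : \sum_y \sum_x f x * w x y = \sum_x f x.
  by rewrite exchange_big/=; apply: eq_bigr => x _; rewrite -mulr_sumr w1 mulr1.
have Q1 : \sum_x Q x = 1.
  have : \sum_y (Q y - \sum_x Q x * w x y + \sum_x Q x) = \sum_(y : X) 1.
    by apply: eq_bigr => y _; exact: qA.
  rewrite big_split sumrB/= exchange subrr add0r !sumr_const -mulr_natr.
  by move=> /esym/eqP; rewrite -[X in X == _]mul1r -subr_eq0 -mulrBl mulf_eq0
    (negbTE cardX0) orbF subr_eq0 => /eqP.
have Qw y : \sum_x Q x * w x y = Q y.
  by have := qA y; rewrite Q1 => /(canRL (addrK 1)); rewrite subrr => /eqP;
     rewrite subr_eq0 => /eqP.
have absQw y : \sum_x `|Q x| * w x y = `|Q y|.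
  have ge z : 0 <= \sum_x `|Q x| * w x z - `|Q z|.
    rewrite subr_ge0 -[in leLHS](Qw z) (le_trans (ler_norm_sum _ _ _))//.
    by apply: ler_sum => x _; rewrite normrM (ger0_norm (w0 x z)).
  apply/eqP; rewrite -subr_eq0.
  have : \sum_z (\sum_x `|Q x| * w x z - `|Q z|) == 0.
    by rewrite sumrB exchange subrr.
  rewrite psumr_eq0 => [/allP/(_ y (mem_index_enum y))//|z _]; exact: ge.
pose S := \sum_x `|Q x|.
have S0 : 0 < S.
  rewrite (lt_le_trans (@ltr01 R))// -Q1 (le_trans (ler_norm _))//.
  exact: ler_norm_sum.
have absS : is_stationary w [ffun x => `|Q x| / S].
  split=> [x||y]; first by rewrite ffunE divr_ge0// ltW.
    by under eq_bigr do rewrite ffunE; rewrite -mulr_suml divff ?gt_eqF.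
  under eq_bigr do rewrite ffunE mulrAC.
  by rewrite ffunE -mulr_suml absQw.
have QabsS x : Q x = `|Q x| / S.
  by rewrite -[LHS](is_stationary_unique wE absS) ffunE.
split=> [x||y].
- by rewrite ffunE -/(Q x) QabsS divr_ge0// ltW.
- by under eq_bigr do rewrite ffunE.
- by under eq_bigr do rewrite ffunE; rewrite ffunE; exact: Qw.
Qed.

Lemma stationaryP w : kernel_on E w -> X -> is_stationary w (stationary w).
Proof.
move=> wE x0; have := balance_solution_stationary wE x0.
by move=> sw; apply: (@xgetPex _ _ (is_stationary w)); eexists; exact: sw.
Qed.

Lemma stationaryE w x : kernel_on E w ->
  stationary w x = balance_solution w 0 (enum_rank x).
Proof. by move=> wE; apply: is_stationary_unique => //;
  exact: stationaryP x. Qed.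

Lemma stationary_gt0 w x : kernel_on E w -> 0 < stationary w x.
Proof.
move=> wE; have [p0 p1 pw] := stationaryP wE x.
have [y y0] : exists y, 0 < stationary w y.
  apply/existsP; apply/contraT; rewrite negb_exists => /forallP p_le.
  have := p1; rewrite big1 => [/eqP|y _]; first by rewrite eq_sym oner_eq0.
  by apply/le_anti; rewrite p0 andbT leNgt.
apply: (@edge_closed_all (fun y => 0 < stationary w y)) y0 => a b a0 ab.
rewrite -pw (bigD1 a)//= ltr_pwDl//.
  by rewrite mulr_gt0// (kernel_on_gt0 wE).
by apply: sumr_ge0 => c _; rewrite mulr_ge0//; have [[/(_ c b)/andP[]]] := wE.
Qed.

Lemma pair_dist_out w x : kernel_on E w ->
  \sum_(y | E x y) pair_dist w x y = stationary w x.
Proof. by move=> wE; rewrite -mulr_sumr kernel_on_sum// mulr1. Qed.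

Lemma pair_dist_in w y : kernel_on E w ->
  \sum_(x | E x y) pair_dist w x y = stationary w y.
Proof.
move=> wE; have [_ _ <-] := stationaryP wE y.
rewrite [RHS](bigID (E^~ y))/= [X in _ + X]big1 ?addr0// => x nE.
by rewrite /pair_dist (kernel_on_out wE nE) mulr0.
Qed.

Lemma Ck_stationary n k (U : set 'rV[R]_n) (w : 'rV[R]_n -> X -> X -> R) x :
  open U -> (forall t, kernel_on E (w t)) ->
  (forall x y, Ck k U (fun t => w t x y)) -> Ck k U (fun t =>
    stationary (w t) x).
Proof.
move=> oU wE Cw.
apply: (@Ck_eq _ _ _ _ (fun t =>
  \sum_i 1 * (invmx (balance_mx (w t))) i (enum_rank x))) => //.
  move=> t _; rewrite stationaryE// mxE.
  by apply: eq_bigr => i _; rewrite mxE.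
apply: Ck_sum => // i _; apply: Ck_mul => //; first exact: Ck_cst.
apply: Ck_invmx => // [t _|a b]; first exact: balance_mx_unit.
apply: (@Ck_eq _ _ _ _ (fun t => (a == b)%:R - w t (enum_val a) (enum_val b) +
  1)) => //.
  by move=> t _; rewrite mxE.
by apply: Ck_add => //; [apply: Ck_sub => //|]; exact: Ck_cst.
Qed.

End MarkovKernelFacts.

(** * Smoothness of the Perron potentials *)

Section PerronPotentials.
Context {R : realType} {X : finType} (E : rel X).
Hypothesis connE : strongly_connected E.
Variables (d : nat) (C : X -> X -> R) (F : 'I_d -> X -> X -> R) (x0 : X).
Let n := #|X|.

(** A vector [z] lists the [d] natural parameters and then one potential per state. [slope x y]
    holds the coefficients of the log-kernel in [z]; the last indicator puts the potential at [x0]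
    in the role of [psi]. *)
Let slope (x y : X) (i : 'I_(d + n)) : R :=
  match fintype.split i with
  | inl k => F k x y
  | inr j => (enum_val j == y)%:R - (enum_val j == x)%:R - (enum_val j == x0)%:R
  end.

Let expo (x y : X) (z : 'rV[R]_(d + n)) := C x y + \sum_i z 0 i * slope x y i.

Let pot (z : 'rV[R]_(d + n)) x := z 0 (rshift d (enum_rank x)).

Let slopeE x y (z : 'rV[R]_(d + n)) : \sum_i z 0 i * slope x y i =
  \sum_k z 0 (lshift n k) * F k x y + (pot z y - pot z x - pot z x0).
Proof.
rewrite big_split_ord/=; congr (_ + _).
  apply: eq_bigr => k _; rewrite /slope.
  by case: split_ordP => k' /eqP; rewrite eq_shift // => /eqP <-.
have pick a : \sum_(j < n) z 0 (rshift d j) * (enum_val j == a)%:R = pot z a.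
  rewrite (bigD1 (enum_rank a))//= enum_rankK eqxx mulr1 big1 ?addr0// => j ja.
  by rewrite -(can_eq enum_valK) enum_rankK in ja; rewrite (negbTE ja) mulr0.
rewrite -(pick y) -(pick x) -(pick x0) -!sumrB; apply: eq_bigr => j _.
rewrite -!mulrBr /slope; congr (_ * _).
by case: split_ordP => k' /eqP; rewrite eq_shift // => /eqP <-.
Qed.

Let is_derive_expo x y z v :
  is_derive z v (fun z => expR (expo x y z))
    (expR (expo x y z) * \sum_i v 0 i * slope x y i).
Proof.
apply: is_derive_comp_real.
rewrite -[\sum_i _]add0r; apply: is_deriveD.
apply: is_derive_bigsum => i _.
have -> : (fun z : 'rV[R]_(d + n) => z 0 i * slope x y i) =
    slope x y i \*: (fun z : 'rV[R]_(d + n) => z 0 i).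
  by apply/funext => t; rewrite /= mulrC.
rewrite mulrC; apply: is_deriveZ; exact: is_derive_coord.
Qed.

(* The inverse of this map solves the normalisation of the rows for the
   potentials. *)
Let row_sums (z : 'rV[R]_(d + n)) : 'rV[R]_(d + n) :=
  row_mx (lsubmx z)
    (\row_j \sum_(y | E (enum_val j) y) expR (expo (enum_val j) y z)).

Let row_sums_l z k : row_sums z 0 (lshift n k) = z 0 (lshift n k).
Proof. by rewrite row_mxEl mxE. Qed.

Let row_sums_r z x : row_sums z 0 (rshift d (enum_rank x)) =
  \sum_(y | E x y) expR (expo x y z).
Proof. by rewrite row_mxEr mxE enum_rankK. Qed.

Let smooth_row_sums : smooth_map_on setT row_sums.
Proof.
move=> l; apply/smooth_onP => k; case: (split_ordP l) => a ->.
  apply: (@Ck_eq _ _ _ _ (fun z => z 0 (lshift n a))); first exact: openT.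
    by move=> z _; rewrite row_sums_l.
  by apply: Ck_coord; exact: openT.
rewrite -[a]enum_valK; apply: (@Ck_eq _ _ _ _ (fun z =>
  \sum_(y | E (enum_val a) y) expR (expo (enum_val a) y z)));
    first exact: openT.
  by move=> z _; rewrite row_sums_r.
apply: Ck_sum => [|y _]; first exact: openT.
apply: Ck_exp; first exact: openT.
apply: Ck_add; [exact: openT|exact: (Ck_cst _ _ openT)|].
apply: Ck_sum => [|i _]; first exact: openT.
by apply: Ck_mul; [exact: openT|exact: (Ck_coord _ _ openT)|exact: (Ck_cst _ _
  openT)].
Qed.

Let sgr_expR_sub1 (s : R) : Num.sg (expR s - 1) = Num.sg s.
Proof.
case: (ltgtP s 0) => [s0|s0|->]; last by rewrite expR0 subrr.
- by rewrite (ltr0_sg s0) ltr0_sg// subr_lt0 expR_lt1.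
- by rewrite (gtr0_sg s0) gtr0_sg// subr_gt0 expR_gt1.
Qed.

(** The difference of the two row sums has terms [expR b * (expR s - 1)], and [expR s - 1] has the
    sign of [s]. *)
Lemma exp_rows_rigid (b : X -> X -> R) (h : X -> R) (c : R) :
  (forall x, \sum_(y | E x y) expR (b x y + (h y - h x - c)) =
             \sum_(y | E x y) expR (b x y)) ->
  c = 0 /\ forall x y, h x = h y.
Proof.
move=> eqsum; apply: (@rigidity _ _ E connE (fun x y s =>
  expR (b x y) * (expR s - 1))) => //.
  move=> x y s _; rewrite sgrM (gtr0_sg (expR_gt0 _)) mul1r.
  exact: sgr_expR_sub1.
move=> x; under eq_bigr do rewrite mulrBr mulr1 -expRD.
by rewrite sumrB eqsum subrr.
Qed.

Let ext_pot (z z' : 'rV[R]_(d + n)) :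
  (forall k, z 0 (lshift n k) = z' 0 (lshift n k)) ->
  (forall x, pot z x = pot z' x) -> z = z'.
Proof.
move=> zl zr; apply/rowP => i; case: (split_ordP i) => j ->; first exact: zl.
by rewrite -[j]enum_valK; exact: zr.
Qed.

(** The difference [h] of two potentials enters [exp_rows_rigid] with [c = h x0]. So [h] is constant
    with value 0 at [x0]: using the potential at [x0] as the normalising constant removes the
    freedom of adding constants. *)
Let inj_row_sums : injective row_sums.
Proof.
move=> z z' zz'.
have zl k : z 0 (lshift n k) = z' 0 (lshift n k) by rewrite -[LHS]row_sums_l
  zz' row_sums_l.
pose h x := pot z' x - pot z x.
have [|h0 hc] := @exp_rows_rigid (fun x y => expo x y z) h (h x0).
  move=> x; rewrite -[RHS]row_sums_r zz' row_sums_r; apply: eq_bigr => y _.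
  congr expR; rewrite /expo !slopeE.
  have -> : \sum_k z 0 (lshift n k) * F k x y =
      \sum_k z' 0 (lshift n k) * F k x y.
    by apply: eq_bigr => k _; rewrite zl.
  by rewrite /h; ring.
apply: ext_pot => // x; have := hc x x0; rewrite h0 => /eqP.
by rewrite subr_eq0 => /eqP.
Qed.

(** The linearisation of the injectivity argument: [rigidity] is applied to [expR (expo x y z) * s],
    with the potential part of a null vector as [h]. *)
Let unit_row_sums z : jacobian_mx row_sums z \in unitmx.
Proof.
rewrite -row_free_unit; apply/inj_row_free => v vJ.
have dl i k : jacobian_mx row_sums z i (lshift n k) = (basis i : 'rV[R]_(d +
  n)) 0 (lshift n k).
  rewrite mxE.
  have -> : (fun y => row_sums y 0 (lshift n k)) = (fun y => y 0 (lshift n k)).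
    by apply/funext => t; rewrite row_sums_l.
  exact: (@derive_val _ _ _ _ _ _ _ (is_derive_coord (lshift n k) z (basis i))).
have dr i x : jacobian_mx row_sums z i (rshift d (enum_rank x)) =
    \sum_(y | E x y) expR (expo x y z) * slope x y i.
  rewrite mxE.
  have -> : (fun y => row_sums y 0 (rshift d (enum_rank x))) =
      (fun z => \sum_(y | E x y) expR (expo x y z)).
    by apply/funext => t; rewrite row_sums_r.
  have D : is_derive z (basis i) (fun z => \sum_(y | E x y) expR (expo x y z))
      (\sum_(y | E x y) expR (expo x y z) * slope x y i).
    apply: is_derive_bigsum => y _; apply: is_derive_eq (is_derive_expo x y z
      _) _.
    congr (_ * _); rewrite (bigD1 i)//= mxE !eqxx mul1r big1 ?addr0// => j ji.
    by rewrite mxE eqxx (negbTE ji) mul0r.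
  exact: (@derive_val _ _ _ _ _ _ _ D).
have vl k : v 0 (lshift n k) = 0.
  have /rowP/(_ (lshift n k)) := vJ; rewrite !mxE => <-.
  rewrite (bigD1 (lshift n k))//= dl mxE !eqxx mulr1 big1 ?addr0// => i ik.
  by rewrite dl mxE eqxx eq_sym (negbTE ik) mulr0.
have [|||h0 hc] := @rigidity _ _ E connE (fun x y s => expR (expo x y z) * s)
    (pot v) (pot v x0).
- by move=> x y s _; rewrite sgrM (gtr0_sg (expR_gt0 _)) mul1r.
- move=> x; have /rowP/(_ (rshift d (enum_rank x))) := vJ; rewrite !mxE => vJx.
  rewrite -[RHS]vJx.
  under [RHS]eq_bigr do rewrite dr mulr_sumr.
  rewrite [RHS]exchange_big/=; apply: eq_bigr => y _.
  under [RHS] eq_bigr do rewrite mulrCA.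
  rewrite -mulr_sumr slopeE [X in _ = _ * (X + _)]big1 ?add0r// => k _.
  by rewrite vl mul0r.
- exact: x0.
apply: ext_pot => [k|x]; first by rewrite vl mxE.
by rewrite (hc x x0) h0 /pot mxE.
Qed.

(** An implicit function obtained from an inverse one: [row_sums] keeps the natural parameters in
    its first block, so [u t] is the potential part of the preimage of [t] followed by ones. *)
Lemma smooth_potential (u : 'rV[R]_d -> X -> R) :
  (forall (t : 'rV[R]_d) x, \sum_(y | E x y)
     expR (C x y + \sum_i t 0 i * F i x y + u t y - u t x - u t x0) = 1) ->
  forall x k, Ck k setT (fun t => u t x).
Proof.
move=> u1 x k.
have [g [gK oR sg]] := inverse_function_theorem smooth_row_sums inj_row_sums
  unit_row_sums.
pose z (t : 'rV[R]_d) : 'rV[R]_(d + n) := row_mx t (\row_j u t (enum_val j)).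
have potz t y : pot (z t) y = u t y by rewrite /pot row_mxEr mxE enum_rankK.
have zE t : row_sums (z t) = row_mx t (const_mx 1).
  rewrite /row_sums row_mxKl; congr row_mx; apply/rowP => j; rewrite !mxE.
  rewrite -[RHS](u1 t (enum_val j)); apply: eq_bigr => y _; congr expR.
  rewrite /expo slopeE !potz !addrA; congr (_ + _ + _ - _ - _).
  by apply: eq_bigr => i _; rewrite row_mxEl.
apply: (@Ck_eq _ _ _ _ (fun t : 'rV[R]_d =>
  g (row_mx t (const_mx 1)) 0 (rshift d (enum_rank x)))).
- exact: openT.
- by move=> t _; rewrite -zE gK; exact: potz.
apply: (@Ck_comp R d (d + n) k setT (range row_sums)
  (fun z => g z 0 (rshift d (enum_rank x)))
  (fun t => row_mx t (const_mx 1)) openT oR).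
- by move=> t _; exists (z t) => //; exact: zE.
- by have /smooth_onP := sg (rshift d (enum_rank x)); exact.
move=> a; case: (split_ordP a) => j ->.
  apply: (@Ck_eq _ _ _ _ (fun t : 'rV[R]_d => t 0 j)); [exact: openT| |].
    by move=> t _; rewrite row_mxEl.
  exact: (Ck_coord _ _ openT).
apply: (@Ck_eq _ _ _ _ (fun t : 'rV[R]_d => 1)); [exact: openT| |].
  by move=> t _; rewrite row_mxEr mxE.
exact: (Ck_cst _ _ openT).
Qed.

End PerronPotentials.

(** * Connections with affine coordinates *)

Section FlatFromAffineCoordinates.
Context {R : realType} {d : nat}.
Local Notation V := 'rV[R]_d.
Implicit Types (U : set V) (f : V -> R) (Y Z T : V -> V) (x : V).

(** The vector field [Y] acting on functions as a derivation. *)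
Definition dirderiv Y f : V -> R := fun x => \sum_i Y x 0 i * partial i f x.

Lemma Ck_dirderiv k U Y f : open U -> (forall a, Ck k U (fun x => Y x 0 a)) ->
  Ck k.+1 U f -> Ck k U (dirderiv Y f).
Proof.
move=> oU CY Cf; apply: Ck_sum => // i _.
by apply: Ck_mul => //; exact: Ck_partial.
Qed.

Lemma dirderiv_eq U Y f g x : open U -> U x -> (forall y, U y -> f y = g y) ->
  dirderiv Y f x = dirderiv Y g x.
Proof.
by move=> oU Ux fg; apply: eq_bigr => i _; rewrite (partial_eq i oU Ux fg).
Qed.

Lemma partial_dirderiv U Z f x i : open U ->
  (forall a, Ck 1 U (fun x => Z x 0 a)) -> Ck 2 U f -> U x ->
  partial i (dirderiv Z f) x =
  \sum_k (Z x 0 k * partial i (partial k f) x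
          + partial k f x * partial i (fun x => Z x 0 k) x).
Proof.
move=> oU CZ Cf Ux.
have D : is_derive x (basis i) (dirderiv Z f)
  (\sum_k (Z x 0 k * partial i (partial k f) x
          + partial k f x * partial i (fun x => Z x 0 k) x)).
  apply: is_derive_bigsum => k _; apply: is_deriveM.
    exact: (Ck_is_derive i (CZ k) Ux).
  exact: (Ck_is_derive i (Ck_partial k Cf) Ux).
exact: (@derive_val _ _ _ _ _ _ _ D).
Qed.

(** The algebra behind the bracket: the second-order terms cancel by symmetry of the Hessian [H],
    and only derivatives of the fields' components remain. *)
Local Lemma commutator_sum (y z g : 'I_d -> R) (A B H : 'I_d -> 'I_d -> R) :
  (forall i k, H i k = H k i) ->
  \sum_i y i * (\sum_k (z k * H i k + g k * A i k)) -
  \sum_i z i * (\sum_k (y k * H i k + g k * B i k)) =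
  \sum_k (\sum_i (y i * A i k - z i * B i k)) * g k.
Proof.
move=> symH.
have expand (u v : 'I_d -> R) D :
    \sum_i u i * (\sum_k (v k * H i k + g k * D i k)) =
    \sum_i \sum_k u i * (v k * H i k) + \sum_k (\sum_i u i * D i k) * g k.
  under eq_bigr do rewrite big_split mulrDr/=.
  rewrite big_split/=; congr (_ + _).
    by apply: eq_bigr => i _; rewrite mulr_sumr.
  under eq_bigr do rewrite mulr_sumr.
  rewrite exchange_big/=; apply: eq_bigr => k _; rewrite mulr_suml.
  by apply: eq_bigr => i _; rewrite mulrCA mulrC.
rewrite !expand.
have -> : \sum_i \sum_k z i * (y k * H i k) = \sum_i \sum_k y i * (z k * H i k).
  rewrite exchange_big/=; apply: eq_bigr => i _; apply: eq_bigr => k _.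
  by rewrite symH mulrCA.
rewrite opprD addrACA subrr add0r -sumrB; apply: eq_bigr => k _.
by rewrite sumrB mulrBl.
Qed.

Lemma dirderiv_bracket U Y Z f x : open U ->
  (forall a, Ck 1 U (fun x => Y x 0 a)) -> (forall a, Ck 1 U (fun x =>
    Z x 0 a)) ->
  Ck 2 U f -> U x ->
  dirderiv Y (dirderiv Z f) x - dirderiv Z (dirderiv Y f) x =
  dirderiv (bracket Y Z) f x.
Proof.
move=> oU CY CZ Cf Ux.
have symH i k : partial i (partial k f) x = partial k (partial i f) x.
  exact: partial_symm oU Cf Ux.
have EZ := partial_dirderiv _ oU CZ Cf Ux.
have EY := partial_dirderiv _ oU CY Cf Ux.
rewrite {1}/dirderiv (eq_bigr _ (fun i _ => congr1 ( *%R (Y x 0 i)) (EZ i))).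
rewrite {1}/dirderiv (eq_bigr _ (fun i _ => congr1 ( *%R (Z x 0 i)) (EY i))).
rewrite commutator_sum//; apply: eq_bigr => k _.
by rewrite mxE.
Qed.

Variables (U : set V) (phi : V -> V) (G : @coefficients R d).
Hypothesis oU : open U.
Hypothesis Cphi : forall k a, Ck k U (fun x => phi x 0 a).
Hypothesis uphi : forall x, U x -> jacobian_mx phi x \in unitmx.
(* phi is a system of affine coordinates for the connection. *)
Hypothesis affG : forall x i j a, U x ->
  \sum_l G i j l x * partial l (fun y => phi y 0 a) x =
  partial i (partial j (fun y => phi y 0 a)) x.

Let phi_ a : V -> R := fun x => phi x 0 a.

Let mul_jacobian (v x : V) a :
  (v *m jacobian_mx phi x) 0 a = \sum_i v 0 i * partial i (phi_ a) x.
Proof. by rewrite mxE; apply: eq_bigr => i _; rewrite mxE. Qed.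

(** By [affG] the coefficients of the connection contribute exactly the second derivatives of
    [phi_ a], which completes the product rule for [Y (Z (phi_ a))]. *)
Let covariant_phi Y Z x a : (forall b, Ck 1 U (fun x => Z x 0 b)) -> U x ->
  (covariant G Y Z x *m jacobian_mx phi x) 0 a =
  dirderiv Y (dirderiv Z (phi_ a)) x.
Proof.
move=> CZ Ux; rewrite mul_jacobian.
under eq_bigr do rewrite mxE mulr_suml.
rewrite exchange_big; apply: eq_bigr => i _ /=.
rewrite (partial_dirderiv _ oU CZ (Cphi 2 a) Ux).
under eq_bigr do rewrite -mulrA.
rewrite -mulr_sumr; congr (_ * _).
under eq_bigr do rewrite mulrDl mulr_suml.
rewrite !big_split/= addrC; congr (_ + _).
  rewrite exchange_big; apply: eq_bigr => j _ /=.
  under eq_bigr do rewrite -mulrA.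
  by rewrite -mulr_sumr affG.
by apply: eq_bigr => l _; rewrite mulrC.
Qed.

(** Curvature differentiates covariant derivatives. Their regularity is read off from
    [covariant_phi] by inverting the Jacobian, since nothing is said about the regularity of [G]. *)
Let Ck_covariant k Y Z b : (forall a, Ck k U (fun x => Y x 0 a)) ->
  (forall a, Ck k.+1 U (fun x => Z x 0 a)) ->
  Ck k U (fun x => covariant G Y Z x 0 b).
Proof.
move=> CY CZ.
apply: (@Ck_eq _ _ _ _ (fun x => \sum_a dirderiv Y (dirderiv Z (phi_ a)) x *
    invmx (jacobian_mx phi x) a b)) => //.
  move=> x Ux; rewrite -[in RHS](mulmxK (uphi Ux) (covariant G Y Z x)) [RHS]mxE.
  apply: eq_bigr => a _; rewrite covariant_phi// => c.
  exact: (Ck1 (CZ c)).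
apply: Ck_sum => // a _; apply: Ck_mul => //.
  by apply: Ck_dirderiv => //; apply: Ck_dirderiv => //; exact: Cphi.
apply: Ck_invmx => // i j; apply: (@Ck_eq _ _ _ _ (partial i (phi_ j))) => //.
  by move=> x _; rewrite mxE.
by apply: Ck_partial; exact: Cphi.
Qed.

(** Tested on [phi_ a], torsion is the commutator of [Y] and [Z] minus the bracket, applied to
    [phi_ a]; curvature is the same operator applied to [dirderiv T (phi_ a)]. *)
Lemma flat_on_affine : flat_on U G.
Proof.
move=> Y Z T sY sZ sT x Ux.
have CY k a : Ck k U (fun x => Y x 0 a) by have /smooth_onP := sY a; exact.
have CZ k a : Ck k U (fun x => Z x 0 a) by have /smooth_onP := sZ a; exact.
have CT k a : Ck k U (fun x => T x 0 a) by have /smooth_onP := sT a; exact.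
have zero v : v *m jacobian_mx phi x = 0 -> v = 0.
  by move=> /(congr1 (mulmx^~ (invmx (jacobian_mx phi x))));
     rewrite mulmxK ?uphi// mul0mx.
have br a : (bracket Y Z x *m jacobian_mx phi x) 0 a =
    dirderiv Y (dirderiv Z (phi_ a)) x
    - dirderiv Z (dirderiv Y (phi_ a)) x.
  rewrite (dirderiv_bracket oU (CY 1%N) (CZ 1%N) (Cphi 2 a) Ux).
  by rewrite mul_jacobian.
split; apply: zero; apply/rowP => a; rewrite !mulmxBl [RHS]mxE.
  rewrite mxE [X in X + _]mxE [X in _ + X + _]mxE [X in _ + X]mxE.
  rewrite (covariant_phi Y a (CZ 1%N) Ux) (covariant_phi Z a (CY 1%N) Ux) br.
  by rewrite subrr.
rewrite mxE [X in X + _]mxE [X in _ + X + _]mxE [X in _ + X]mxE.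
have Ccov Y' k b : (forall k a, Ck k U (fun x => Y' x 0 a)) ->
    Ck k U (fun x => covariant G Y' T x 0 b).
  by move=> CY'; apply: Ck_covariant => c; [exact: CY'|exact: CT].
have cov2 Y' Z' : (forall k a, Ck k U (fun x => Z' x 0 a)) ->
    (covariant G Y' (covariant G Z' T) x *m jacobian_mx phi x) 0 a =
    dirderiv Y' (dirderiv Z' (dirderiv T (phi_ a))) x.
  move=> CZ'; rewrite (covariant_phi Y' a (fun b => Ccov Z' 1%N b CZ') Ux).
  apply: (dirderiv_eq _ oU Ux) => y Uy.
  by rewrite -[RHS](covariant_phi _ _ (CT 1%N) Uy) mul_jacobian.
rewrite (cov2 Y Z CZ) (cov2 Z Y CY) (covariant_phi _ _ (CT 1%N) Ux).
have CTphi : Ck 2 U (dirderiv T (phi_ a)).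
  by apply: Ck_dirderiv => //; exact: Cphi.
by rewrite (dirderiv_bracket oU (CY 1%N) (CZ 1%N) CTphi Ux) subrr.
Qed.

End FlatFromAffineCoordinates.

(** * Fisher metric and connections of an exponential family *)

Lemma jacobian_comp (R : realType) n m k (U : set 'rV[R]_n) (V : set 'rV[R]_m)
    (f : 'rV[R]_m -> 'rV[R]_k) (phi : 'rV[R]_n -> 'rV[R]_m) x :
  open V -> (forall a, Ck 1 U (fun y => phi y 0 a)) ->
  (forall a, Ck 1 V (fun y => f y 0 a)) -> U x -> V (phi x) ->
  jacobian_mx (fun y => f (phi y)) x =
  jacobian_mx phi x *m jacobian_mx f (phi x).
Proof.
move=> oV Cphi Cf Ux Vx; apply/matrixP => i l; rewrite !mxE.
have D : is_derive x (basis i) ((fun y => f y 0 l) \o phi)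
    (\sum_a 'D_(basis i) (fun t => phi t 0 a) x *
            partial a (fun y => f y 0 l) (phi x)).
  apply: (is_derive_comp_row oV (Cf l) Vx) => a.
  by have [] := Ck_is_derive i (Cphi a) Ux.
rewrite [LHS](@derive_val _ _ _ _ _ _ _ D).
by apply: eq_bigr => a _; rewrite !mxE.
Qed.

Section ExponentialFamilyGeometry.
Context {R : realType} {X : finType} (E : rel X) {d : nat}.
Local Notation V := 'rV[R]_d.
Hypothesis connE : strongly_connected E.
Variable x0 : X.
Variables (w : V -> X -> X -> R) (C : X -> X -> R) (F : 'I_d -> X -> X -> R).
(** The parameter of [w] is here an arbitrary chart, in which [phi] expresses the natural
    parameters. One computation thus serves the natural chart, the expectation chart and all local
    charts. *)
Variables (U : set V) (phi : V -> V) (k : X -> V -> R) (kappa : V -> R).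
Hypothesis wE : forall s, kernel_on E (w s).
Hypothesis oU : open U.
Hypothesis Cphi : forall m a, Ck m U (fun s => phi s 0 a).
Hypothesis Ck_k : forall m x, Ck m U (k x).
Hypothesis Ckappa : forall m, Ck m U kappa.
Hypothesis log_w : forall s x y, E x y ->
  ln (w s x y) = C x y + \sum_a phi s 0 a * F a x y + k y s - k x s - kappa s.

Local Notation eta := (expectation_parameter E w F).
Local Notation P := (pair_prob w).
Local Notation lw := (log_kernel w).

Lemma Ck_log_kernel m x y : E x y -> Ck m U (lw x y).
Proof.
move=> xy; apply: (@Ck_eq _ _ _ _ (fun s =>
  C x y + \sum_a phi s 0 a * F a x y + k y s - k x s - kappa s)) => //.
  by move=> s _; rewrite /log_kernel log_w.
apply: Ck_sub => //; apply: Ck_sub => //; apply: Ck_add => //.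
apply: Ck_add => //; first exact: Ck_cst.
by apply: Ck_sum => // a _; apply: Ck_mul => //; exact: Ck_cst.
Qed.

Lemma Ck_kernel m x y : Ck m U (fun s => w s x y).
Proof.
have [xy|nE] := boolP (E x y); last first.
  apply: (@Ck_eq _ _ _ _ (fun=> 0)) (Ck_cst _ _ oU) => // s _.
  by rewrite (kernel_on_out (wE s) nE).
apply: (@Ck_eq _ _ _ _ (fun s => expR (lw x y s))) => //.
  by move=> s _; rewrite /log_kernel lnK// posrE; exact: kernel_on_gt0 xy.
by apply: Ck_exp => //; exact: Ck_log_kernel.
Qed.

Lemma Ck_stat m x : Ck m U (fun s => stationary (w s) x).
Proof. by apply: (Ck_stationary connE) => // ? ?; exact: Ck_kernel. Qed.

Lemma Ck_pair_prob m x y : Ck m U (P x y).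
Proof. by apply: Ck_mul => //; [exact: Ck_stat|exact: Ck_kernel]. Qed.

Lemma Ck_expectation m a : Ck m U (fun s => eta s 0 a).
Proof.
apply: (@Ck_eq _ _ _ _ (fun s => \sum_x \sum_(y | E x y) P x y s * F a x y)) =>
  //.
  by move=> s _; rewrite mxE.
apply: Ck_sum => // x _; apply: Ck_sum => // y _.
by apply: Ck_mul => //; [exact: Ck_pair_prob|exact: Ck_cst].
Qed.

(* Both marginals of the pair distribution agree, so a coboundary
   alpha y - alpha x integrates to 0. *)
Lemma pairing_eq (h : 'I_d -> R) (alpha : X -> R) (c : R) s :
  \sum_x \sum_(y | E x y)
    (\sum_a h a * F a x y + alpha y - alpha x - c) * P x y s =
  \sum_a h a * eta s 0 a - c.
Proof.
transitivity (\sum_x \sum_(y | E x y) (\sum_a h a * F a x y) * P x y s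
  + \sum_x \sum_(y | E x y) alpha y * P x y s
  - \sum_x \sum_(y | E x y) alpha x * P x y s
  - \sum_x \sum_(y | E x y) c * P x y s).
  rewrite -big_split -!sumrB/=; apply: eq_bigr => x _.
  rewrite -big_split -!sumrB/=; apply: eq_bigr => y _.
  by rewrite !mulrBl mulrDl.
have -> : \sum_x \sum_(y | E x y) alpha x * P x y s =
    \sum_x alpha x * stationary (w s) x.
  apply: eq_bigr => x _; rewrite -mulr_sumr; congr (_ * _).
  exact: (pair_dist_out x (wE s)).
have -> : \sum_x \sum_(y | E x y) alpha y * P x y s =
    \sum_x alpha x * stationary (w s) x.
  rewrite (exchange_big_dep xpredT)//=; apply: eq_bigr => y _.
  by rewrite -mulr_sumr; congr (_ * _); exact: (pair_dist_in connE y (wE s)).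
rewrite addrK; congr (_ - _).
  under eq_bigr => x _.
    under eq_bigr => y _ do rewrite mulr_suml.
    rewrite exchange_big; over.
  rewrite exchange_big/=; apply: eq_bigr => a _.
  rewrite mxE mulr_sumr; apply: eq_bigr => x _.
  rewrite mulr_sumr; apply: eq_bigr => y _.
  by rewrite -mulrA; congr (_ * _); exact: mulrC.
transitivity (c * \sum_x stationary (w s) x).
  rewrite mulr_sumr; apply: eq_bigr => x _; rewrite -mulr_sumr; congr (_ * _).
  exact: (pair_dist_out x (wE s)).
by have [_ -> _] := stationaryP connE (wE s) x0; rewrite mulr1.
Qed.

Let partial_pairing (m : X -> X -> R) (Q : X -> X -> V -> R) i s :
  (forall x y, E x y -> Ck 1 U (Q x y)) -> U s ->
  partial i (fun t => \sum_x \sum_(y | E x y) m x y * Q x y t) s =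
  \sum_x \sum_(y | E x y) m x y * partial i (Q x y) s.
Proof.
move=> CQ Us.
have D : is_derive s (basis i)
    (fun t => \sum_x \sum_(y | E x y) m x y * Q x y t)
    (\sum_x \sum_(y | E x y) m x y * partial i (Q x y) s).
  apply: is_derive_bigsum => x _; apply: is_derive_bigsum => y xy.
  have dQ := Ck_is_derive i (CQ x y xy) Us.
  exact: (is_deriveZ (m x y) dQ).
exact: (@derive_val _ _ _ _ _ _ _ D).
Qed.

Let partial_combination (h : 'I_d -> R) (c : R) (Q : 'I_d -> V -> R) i s :
  (forall a, Ck 1 U (Q a)) -> U s ->
  partial i (fun t => \sum_a h a * Q a t - c) s =
  \sum_a h a * partial i (Q a) s.
Proof.
move=> CQ Us.
have D : is_derive s (basis i) (fun t => \sum_a h a * Q a t - c)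
    (\sum_a h a * partial i (Q a) s - 0).
  apply: is_deriveB; apply: is_derive_bigsum => a _.
  have dQ := Ck_is_derive i (CQ a) Us.
  exact: (is_deriveZ (h a) dQ).
by rewrite [LHS](@derive_val _ _ _ _ _ _ _ D) subr0.
Qed.

Let eta_ a : V -> R := fun s => eta s 0 a.

(** The identity [pairing_eq] is differentiated with [h], [alpha] and [c] held constant. They may
    then be replaced by derivatives of [phi], [k] and [kappa] at the same point [s]. *)
Lemma pairing_partial (h : 'I_d -> R) (alpha : X -> R) (c : R) i s : U s ->
  \sum_x \sum_(y | E x y)
    (\sum_a h a * F a x y + alpha y - alpha x - c) * partial i (P x y) s =
  \sum_a h a * partial i (eta_ a) s.
Proof.
move=> Us; rewrite -partial_pairing// => [|x y _]; last exact: Ck_pair_prob.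
under eq_fun do rewrite pairing_eq.
by apply: partial_combination => // a; exact: Ck_expectation.
Qed.

Lemma pairing_partial2 (h : 'I_d -> R) (alpha : X -> R) (c : R) i j s : U s ->
  \sum_x \sum_(y | E x y) (\sum_a h a * F a x y + alpha y - alpha x - c) *
    partial i (partial j (P x y)) s =
  \sum_a h a * partial i (partial j (eta_ a)) s.
Proof.
move=> Us; rewrite -partial_pairing// => [|x y _]; last first.
  by apply: Ck_partial; exact: Ck_pair_prob.
(* The dummy [- 0] matches the shape of [partial_combination]; the constant already vanished with
   the first derivative. *)
have -> : \sum_a h a * partial i (partial j (eta_ a)) s =
    partial i (fun t => \sum_a h a * partial j (eta_ a) t - 0) s.
  rewrite partial_combination// => a.
  by apply: Ck_partial; exact: Ck_expectation.
apply: (partial_eq _ oU Us) => t Ut.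
by rewrite pairing_partial// subr0.
Qed.

Lemma partial_log_kernel i x y s : E x y -> U s ->
  partial i (lw x y) s = \sum_a partial i (fun t => phi t 0 a) s * F a x y
    + partial i (k y) s - partial i (k x) s - partial i kappa s.
Proof.
move=> xy Us.
have D : is_derive s (basis i) (lw x y) (0 +
    \sum_a partial i (fun t => phi t 0 a) s * F a x y
    + partial i (k y) s - partial i (k x) s - partial i kappa s).
  have -> : lw x y = fun s =>
      C x y + \sum_a phi s 0 a * F a x y + k y s - k x s - kappa s.
    by apply/funext => t; exact: log_w.
  apply: is_deriveB; last exact: (Ck_is_derive i (Ckappa 1) Us).
  apply: is_deriveB; last exact: (Ck_is_derive i (Ck_k 1 x) Us).
  apply: is_deriveD; last exact: (Ck_is_derive i (Ck_k 1 y) Us).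
  apply: is_deriveD; apply: is_derive_bigsum => a _.
  have dphi := Ck_is_derive i (Cphi 1 a) Us.
  rewrite mulrC.
  have -> : (fun t => phi t 0 a * F a x y) = F a x y \*: (fun t => phi t 0 a).
    by apply/funext => t; rewrite /= mulrC.
  exact: (is_deriveZ (F a x y) dphi).
by rewrite [LHS](@derive_val _ _ _ _ _ _ _ D) add0r.
Qed.

Lemma partial2_log_kernel i j x y s : E x y -> U s ->
  partial i (partial j (lw x y)) s =
  \sum_a partial i (partial j (fun t => phi t 0 a)) s * F a x y
    + partial i (partial j (k y)) s - partial i (partial j (k x)) s
    - partial i (partial j kappa) s.
Proof.
move=> xy Us.
rewrite (partial_eq i oU Us (fun t Ut => partial_log_kernel j xy Ut)).
have D : is_derive s (basis i) (fun s =>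
    \sum_a partial j (fun t => phi t 0 a) s * F a x y
    + partial j (k y) s - partial j (k x) s - partial j kappa s)
  (\sum_a partial i (partial j (fun t => phi t 0 a)) s * F a x y
    + partial i (partial j (k y)) s - partial i (partial j (k x)) s
    - partial i (partial j kappa) s).
  apply: is_deriveB; last exact: (Ck_is_derive i (Ck_partial j (Ckappa 2)) Us).
  apply: is_deriveB; last exact: (Ck_is_derive i (Ck_partial j (Ck_k 2 x)) Us).
  apply: is_deriveD; last exact: (Ck_is_derive i (Ck_partial j (Ck_k 2 y)) Us).
  apply: is_derive_bigsum => a _.
  have dphi := Ck_is_derive i (Ck_partial j (Cphi 2 a)) Us.
  rewrite mulrC.
  have -> : (fun t => partial j (fun t => phi t 0 a) t * F a x y) =
      F a x y \*: partial j (fun t => phi t 0 a).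
    by apply/funext => t; rewrite /= mulrC.
  exact: (is_deriveZ (F a x y) dphi).
exact: (@derive_val _ _ _ _ _ _ _ D).
Qed.

Lemma Gamma_eE i j l s : U s -> Gamma_e E w i j l s =
  \sum_a partial i (partial j (fun t => phi t 0 a)) s * jacobian_mx eta s l a.
Proof.
move=> Us; under [RHS]eq_bigr do rewrite mxE.
rewrite -(pairing_partial _ (fun x => partial i (partial j (k x)) s)
  (partial i (partial j kappa) s))//.
apply: eq_bigr => x _; apply: eq_bigr => y xy.
by rewrite partial2_log_kernel.
Qed.

Lemma Gamma_mE i j l s : U s -> Gamma_m E w i j l s =
  \sum_a partial i (partial j (eta_ a)) s * jacobian_mx phi s l a.
Proof.
move=> Us; under [RHS]eq_bigr do rewrite mxE mulrC.
rewrite -(pairing_partial2 _ (fun x => partial l (k x) s) (partial l kappa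
  s))//.
apply: eq_bigr => x _; apply: eq_bigr => y xy.
by rewrite partial_log_kernel// mulrC.
Qed.

(** Differentiating [P = p * w] gives [P] times the score plus [w] times the derivative of the
    stationary weight of [x]. That weight does not involve [y], so the extra term is multiplied by
    the derivative of a row sum, which is 0. *)
Let score i j s : U s -> fisher E w s i j =
  \sum_x \sum_(y | E x y) partial i (lw x y) s * partial j (P x y) s.
Proof.
move=> Us; rewrite mxE; apply: eq_bigr => x _.
have dw i' y : E x y -> is_derive s (basis i') (fun s => w s x y)
    (w s x y * partial i' (lw x y) s).
  move=> xy; have dl := Ck_is_derive i' (Ck_log_kernel 1 xy) Us.
  have wlw t : expR (lw x y t) = w t x y.
    by rewrite /log_kernel lnK// posrE; exact: kernel_on_gt0 xy.
  have -> : (fun s => w s x y) = (fun s => expR (lw x y s)).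
    by apply/funext => t; rewrite wlw.
  by rewrite -wlw; apply: is_derive_comp_real.
have sum0 : \sum_(y | E x y) w s x y * partial i (lw x y) s = 0.
  have D : is_derive s (basis i) (fun s => \sum_(y | E x y) w s x y)
    (\sum_(y | E x y) w s x y * partial i (lw x y) s).
    by apply: is_derive_bigsum => y; exact: dw.
  rewrite -[LHS](@derive_val _ _ _ _ _ _ _ D).
  have -> : (fun s => \sum_(y | E x y) w s x y) = cst 1.
    by apply/funext => t; exact: kernel_on_sum.
  exact: derive_cst.
have dP y : E x y -> partial j (P x y) s =
    P x y s * partial j (lw x y) s +
    w s x y * partial j (fun s => stationary (w s) x) s.
  move=> xy; have dp := Ck_is_derive j (Ck_stat 1 x) Us.
  have D := is_deriveM dp (dw j y xy).
  by rewrite [LHS](@derive_val _ _ _ _ _ _ _ D) -[_ *: (w _ _ _ * _)]/(_ * _)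
    mulrA.
transitivity (\sum_(y | E x y) (partial i (lw x y) s * partial j (P x y) s -
    (w s x y * partial i (lw x y) s) * partial j (fun s =>
      stationary (w s) x) s)).
  apply: eq_bigr => y xy; rewrite dP// mulrDr.
  move: (P x y s) (partial i _ s) (partial j (lw x y) s) (w s x y) (partial j _
    s).
  by move=> a b c' d' e; ring.
by rewrite sumrB -mulr_suml sum0 mul0r subr0.
Qed.

Lemma fisherE s : U s ->
  fisher E w s = jacobian_mx phi s *m (jacobian_mx eta s)^T.
Proof.
move=> Us; apply/matrixP => i j; rewrite score// [RHS]mxE.
under [RHS]eq_bigr do rewrite mxE [(_^T) _ _]mxE [jacobian_mx eta _ _ _]mxE.
rewrite -(pairing_partial _ (fun x => partial i (k x) s) (partial i kappa s))//.
apply: eq_bigr => x _; apply: eq_bigr => y xy.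
by rewrite partial_log_kernel.
Qed.

Hypothesis ufisher : forall s, U s -> fisher E w s \in unitmx.

Lemma jacobian_natural_unit s : U s -> jacobian_mx phi s \in unitmx.
Proof. by move=> Us; have := ufisher Us; rewrite fisherE// unitmx_mul =>
  /andP[]. Qed.

Lemma jacobian_expectation_unit s : U s -> jacobian_mx eta s \in unitmx.
Proof.
by move=> Us; have := ufisher Us; rewrite fisherE// unitmx_mul unitmx_tr =>
  /andP[].
Qed.

Let fisher_sym s : (fisher E w s)^T = fisher E w s.
Proof.
apply/matrixP => i j; rewrite !mxE; apply: eq_bigr => x _;
  apply: eq_bigr => y _.
exact: mulrAC.
Qed.

Lemma exp_connection_affine s i j a : U s ->
  \sum_l exp_connection E w i j l s * partial l (fun t => phi t 0 a) s =
  partial i (partial j (fun t => phi t 0 a)) s.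
Proof.
move=> Us; set J := jacobian_mx phi s; set N := jacobian_mx eta s.
pose H : 'rV[R]_d := \row_b partial i (partial j (fun t => phi t 0 b)) s.
pose S := invmx (fisher E w s).
(* The metric is [J *m N^T], so [N^T *m S] is a right inverse of [J], hence also a left inverse. *)
have NSJ : N^T *m S *m J = 1%:M.
  by apply: mulmx1C; rewrite mulmxA -fisherE// mulmxV// ufisher.
transitivity ((H *m N^T *m S *m J) 0 a); last first.
  by rewrite -!mulmxA (mulmxA N^T) NSJ mulmx1 mxE.
rewrite [RHS]mxE; apply: eq_bigr => l _; rewrite [J l a]mxE; congr (_ * _).
rewrite [RHS]mxE; apply: eq_bigr => b _; congr (_ * _).
rewrite Gamma_eE// [RHS]mxE; apply: eq_bigr => c _.
by rewrite [H _ _]mxE [(N^T) _ _]mxE.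
Qed.

Lemma mix_connection_affine s i j a : U s ->
  \sum_l mix_connection E w i j l s * partial l (eta_ a) s =
  partial i (partial j (eta_ a)) s.
Proof.
move=> Us; set J := jacobian_mx phi s; set N := jacobian_mx eta s.
pose H : 'rV[R]_d := \row_b partial i (partial j (eta_ b)) s.
pose S := invmx (fisher E w s).
have JSN : J^T *m S *m N = 1%:M.
  apply: mulmx1C; rewrite mulmxA.
  (* Symmetry of the metric supplies the factorisation with the two Jacobians exchanged. *)
  have -> : N *m J^T = fisher E w s by rewrite -fisher_sym fisherE// trmx_mul
    trmxK.
  by rewrite mulmxV// ufisher.
transitivity ((H *m J^T *m S *m N) 0 a); last first.
  by rewrite -!mulmxA (mulmxA J^T) JSN mulmx1 mxE.
rewrite [RHS]mxE; apply: eq_bigr => l _; rewrite [N l a]mxE; congr (_ * _).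
rewrite [RHS]mxE; apply: eq_bigr => b _; congr (_ * _).
rewrite Gamma_mE// [RHS]mxE; apply: eq_bigr => c _.
by rewrite [H _ _]mxE [(J^T) _ _]mxE.
Qed.

Lemma flat_on_exp : flat_on U (exp_connection E w).
Proof.
apply: (flat_on_affine (phi := phi)) => //; first exact: jacobian_natural_unit.
by move=> s i j a; exact: exp_connection_affine.
Qed.

Lemma flat_on_mix : flat_on U (mix_connection E w).
Proof.
apply: (flat_on_affine (phi := eta)) => //.
- exact: Ck_expectation.
- exact: jacobian_expectation_unit.
- by move=> s i j a; exact: mix_connection_affine.
Qed.

End ExponentialFamilyGeometry.

(** * Positive definiteness and the expectation chart *)

Section GlobalStructure.
Context {R : realType} {X : finType} (E : rel X) {d : nat}.
Local Notation V := 'rV[R]_d.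
Hypothesis connE : strongly_connected E.
Variable x0 : X.
Variables (w : V -> X -> X -> R) (C : X -> X -> R) (F : 'I_d -> X -> X -> R).
Variables (K : V -> X -> R) (psi : V -> R).
Hypothesis wE : forall t, kernel_on E (w t).
Hypothesis inj_w : injective w.
Hypothesis ln_w : forall t x y, E x y ->
  ln (w t x y) = C x y + \sum_i t 0 i * F i x y + K t y - K t x - psi t.

Local Notation eta := (expectation_parameter E w F).

(* K is determined only up to an additive constant depending on t. Choosing it
   so that psi t becomes the potential at x0 makes K unique, hence smooth. *)
Let u (t : V) x := K t x + psi t - K t x0.

Let ln_wu t x y : E x y ->
  ln (w t x y) = C x y + \sum_i t 0 i * F i x y + u t y - u t x - u t x0.
Proof. by move=> xy; rewrite ln_w// /u; ring. Qed.

Let exp_wu t x y : E x y ->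
  w t x y = expR (C x y + \sum_i t 0 i * F i x y + u t y - u t x - u t x0).
Proof.
by move=> xy; rewrite -ln_wu// lnK// posrE; exact: kernel_on_gt0 xy.
Qed.

Let Cu m x : Ck m setT (fun t => u t x).
Proof.
apply: (smooth_potential connE (C := C) (F := F) (x0 := x0)) => t {}x.
rewrite -[RHS](kernel_on_sum x (wE t)).
by apply: eq_bigr => y xy; rewrite exp_wu.
Qed.

(** * The family in an arbitrary chart with inverse [phi] *)

Section Reparametrized.
Variables (U : set V) (phi : V -> V).
Hypothesis oU : open U.
Hypothesis Cphi : forall m a, Ck m U (fun s => phi s 0 a).

Let k x s := u (phi s) x.

Let Ck_k m x : Ck m U (k x).
Proof.
exact: (@Ck_comp R d d m U setT (fun t => u t x) phi oU openT (fun _ _ => I)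
  (Cu m x) (Cphi m)).
Qed.

Let wphiE s : kernel_on E ((w \o phi) s).
Proof. exact: wE. Qed.

Let log_wphi s x y : E x y -> ln ((w \o phi) s x y) =
  C x y + \sum_a phi s 0 a * F a x y + k y s - k x s - k x0 s.
Proof. exact: ln_wu. Qed.

Lemma fisher_reparam s : U s ->
  fisher E (w \o phi) s = jacobian_mx phi s *m
    (jacobian_mx (expectation_parameter E (w \o phi) F) s)^T.
Proof.
exact: (fisherE connE x0 wphiE oU Cphi Ck_k (fun m => Ck_k m x0) log_wphi).
Qed.

Lemma flat_on_exp_reparam :
  (forall s, U s -> fisher E (w \o phi) s \in unitmx) ->
  flat_on U (exp_connection E (w \o phi)).
Proof.
exact: (flat_on_exp connE x0 wphiE oU Cphi Ck_k (fun m => Ck_k m x0) log_wphi).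
Qed.

Lemma flat_on_mix_reparam :
  (forall s, U s -> fisher E (w \o phi) s \in unitmx) ->
  flat_on U (mix_connection E (w \o phi)).
Proof.
exact: (flat_on_mix connE x0 wphiE oU Cphi Ck_k (fun m => Ck_k m x0) log_wphi).
Qed.

Lemma exp_affine_reparam s i j a :
  (forall s, U s -> fisher E (w \o phi) s \in unitmx) -> U s ->
  \sum_l exp_connection E (w \o phi) i j l s * partial l (fun t =>
    phi t 0 a) s =
  partial i (partial j (fun t => phi t 0 a)) s.
Proof.
move=> uf; exact: (exp_connection_affine connE x0 wphiE oU Cphi Ck_k
  (fun m => Ck_k m x0) log_wphi uf).
Qed.

Lemma mix_affine_reparam s i j a :
  (forall s, U s -> fisher E (w \o phi) s \in unitmx) -> U s ->
  \sum_l mix_connection E (w \o phi) i j l s * partial l (fun t =>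
    eta (phi t) 0 a) s =
  partial i (partial j (fun t => eta (phi t) 0 a)) s.
Proof.
move=> uf; exact: (mix_connection_affine connE x0 wphiE oU Cphi Ck_k
  (fun m => Ck_k m x0) log_wphi uf).
Qed.

End Reparametrized.

Let Cid m a : Ck m setT (fun t : V => (id t) 0 a).
Proof. exact: (Ck_coord _ _ openT). Qed.

Let jacobian_id (t : V) : jacobian_mx id t = 1%:M.
Proof.
by apply/matrixP => i j; rewrite mxE [RHS]mxE; exact: partial_coord.
Qed.

Lemma fisher_natural t : fisher E w t = (jacobian_mx eta t)^T.
Proof. by rewrite (@fisher_reparam setT id openT Cid)// jacobian_id mul1mx. Qed.

Lemma smooth_family x y : smooth_on setT (fun t => w t x y).
Proof.
apply/smooth_onP => m.
exact: (Ck_kernel (phi := id) (k := fun x t => u t x) (kappa := fun t => u t x0)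
  wE openT Cid Cu (fun m => Cu m x0) ln_wu).
Qed.

Lemma smooth_expectation : smooth_map_on setT eta.
Proof.
move=> a; apply/smooth_onP => m.
exact: (Ck_expectation connE (phi := id) (k := fun x t => u t x)
  (kappa := fun t => u t x0) wE openT Cid Cu (fun m => Cu m x0) ln_wu).
Qed.

Let dlog i x y t : E x y -> partial i (log_kernel w x y) t =
  F i x y + partial i (fun t => u t y) t - partial i (fun t => u t x) t
  - partial i (fun t => u t x0) t.
Proof.
move=> xy; have := partial_log_kernel (phi := id) (k := fun x t => u t x)
  (kappa := fun t => u t x0) Cid Cu (fun m => Cu m x0) ln_wu i xy (I : setT t).
move=> ->; congr (_ + _ - _ - _).
have -> : \sum_a partial i (fun t : V => (id t) 0 a) t * F a x y =
    \sum_a jacobian_mx id t i a * F a x y.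
  by apply: eq_bigr => a _; rewrite mxE.
rewrite jacobian_id (bigD1 i)//= mxE eqxx mul1r big1 ?addr0// => a ai.
by rewrite mxE eq_sym (negbTE ai) mul0r.
Qed.

Let fisher_form t (v : V) : (v *m fisher E w t *m v^T) 0 0 =
  \sum_x \sum_(y | E x y) pair_prob w x y t *
    (\sum_i v 0 i * partial i (log_kernel w x y) t) ^+ 2.
Proof.
rewrite mxE; under eq_bigr do rewrite [(v *m _) _ _]mxE [(v^T) _ _]mxE
  mulr_suml.
transitivity (\sum_j \sum_i \sum_x \sum_(y | E x y) (pair_prob w x y t *
    ((v 0 i * partial i (log_kernel w x y) t) *
     (v 0 j * partial j (log_kernel w x y) t)))).
  apply: eq_bigr => j _; apply: eq_bigr => i _.
  rewrite [fisher _ _ _ _ _]mxE mulr_sumr mulr_suml; apply: eq_bigr => x _.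
  rewrite mulr_sumr mulr_suml; apply: eq_bigr => y _.
  move: (v 0 i) (v 0 j) (pair_prob w x y t) (partial i _ t) (partial j _ t).
  by move=> a b c e f; ring.
under eq_bigr do rewrite exchange_big/=.
rewrite exchange_big/=; apply: eq_bigr => x _.
under eq_bigr do rewrite exchange_big/=.
rewrite exchange_big/=; apply: eq_bigr => y _.
rewrite expr2 mulr_suml mulr_sumr exchange_big/=; apply: eq_bigr => i _.
by rewrite mulr_sumr mulr_sumr.
Qed.

Lemma fisher_posdef t (v : V) : v != 0 -> 0 < (v *m fisher E w t *m v^T) 0 0.
Proof.
have pair0 x y : E x y -> 0 < pair_prob w x y t.
  by move=> xy; rewrite mulr_gt0 ?(stationary_gt0 connE)// (kernel_on_gt0 (wE
    t)).
have term0 x y : E x y -> 0 <= pair_prob w x y t *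
    (\sum_i v 0 i * partial i (log_kernel w x y) t) ^+ 2.
  by move=> /pair0/ltW P0; rewrite mulr_ge0 ?sqr_ge0.
rewrite fisher_form lt_neqAle sumr_ge0 ?andbT => [v0|x _]; last first.
  by apply: sumr_ge0 => y; exact: term0.
apply: contra_neq v0 => /esym/eqP; rewrite psumr_eq0 => [/allP sum0|x _];
  last first.
  by apply: sumr_ge0 => y; exact: term0.
have score0 x y : E x y -> \sum_i v 0 i * partial i (log_kernel w x y) t = 0.
  move=> xy; have := sum0 x (mem_index_enum x); rewrite /= psumr_eq0;
    last first.
    by move=> z; exact: term0.
  move=> /allP/(_ y (mem_index_enum y)); rewrite xy/= mulf_eq0 sqrf_eq0.
  by rewrite (gt_eqF (pair0 x y xy))/= => /eqP.
(* [a] is the derivative of the potential along [v]; a vanishing score makes [v . F] the coboundary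
   of [- a] plus the constant [a x0]. *)
pose a x := \sum_i v 0 i * partial i (fun t => u t x) t.
have cob x y : E x y -> \sum_i v 0 i * F i x y = a x + a x0 - a y.
  move=> xy; have := score0 x y xy.
  under eq_bigr do rewrite (dlog _ _ xy) !mulrBr mulrDr.
  rewrite !sumrB big_split/= -/(a x) -/(a y) -/(a x0) => eq0.
  by apply/eqP; rewrite -subr_eq0 -[X in _ == X]eq0; apply/eqP; ring.
(* [h] is the error of the first-order expansion of the potential. The kernels at [t + v] and [t]
   differ in logarithm by [h y - h x - h x0], and both have unit row sums, so [exp_rows_rigid] makes
   [h] vanish. *)
pose h x := u (t + v) x - u t x - a x.
have lnv x y : E x y -> ln (w (t + v) x y) = ln (w t x y) + (h y - h x - h x0).
  move=> xy; rewrite !ln_wu//.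
  have -> : \sum_i (t + v) 0 i * F i x y =
      \sum_i t 0 i * F i x y + (a x + a x0 - a y).
    rewrite -cob// -big_split/=; apply: eq_bigr => i _.
    by rewrite mxE mulrDl.
  by rewrite /h; ring.
have wln s x y : E x y -> expR (ln (w s x y)) = w s x y.
  by move=> xy; rewrite lnK// posrE; exact: kernel_on_gt0 xy.
have [|h0 hc] := exp_rows_rigid connE (b := fun x y => ln (w t x y)) (h :=
  h) (c := h x0) x0.
  move=> x; rewrite (eq_bigr (w (t + v) x)) => [|y xy];
    last by rewrite -lnv// wln.
  rewrite [RHS](eq_bigr (w t x)) => [|y xy]; last by rewrite wln.
  by rewrite !kernel_on_sum.
have : t + v = t.
  apply: inj_w; apply/funext => x; apply/funext => y.
  have [xy|nE] := boolP (E x y); last by rewrite !(kernel_on_out (wE _) nE).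
  rewrite -[LHS](wln _ _ _ xy) -[RHS](wln _ _ _ xy) (lnv _ _ xy).
  by rewrite h0 (hc x y) subrr subr0 addr0.
by move=> /eqP; rewrite -subr_eq0 addrAC subrr add0r => /eqP.
Qed.

Lemma fisher_unit t : fisher E w t \in unitmx.
Proof.
rewrite -row_free_unit; apply/inj_row_free => v v0.
apply/eqP/contraT => /(fisher_posdef t).
by rewrite v0 mul0mx mxE ltxx.
Qed.

Lemma inj_expectation : injective eta.
Proof.
move=> t t' tt'; apply/eqP; rewrite eq_sym -subr_eq0; apply/contraT => v0.
set v := t' - t in v0.
(* The derivative of [q] along [v] is the Fisher norm of [v], positive everywhere; equal values of
   [q] at [t] and [t'] would make it vanish somewhere on the segment. *)
pose q (s : V) := \sum_a v 0 a * eta s 0 a.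
have dq (s : V) : is_derive s v q ((v *m jacobian_mx eta s *m v^T) 0 0).
  rewrite mxE; under eq_bigr do rewrite mulrC [(v^T) _ _]mxE.
  apply: is_derive_bigsum => a _.
  have Ca : Ck 1 setT (fun s => eta s 0 a).
    by have /smooth_onP := smooth_expectation a; exact.
  have := is_derive_comp_row (phi := id) (x := s) (v := v) openT Ca I
    (fun b => @ex_derive _ _ _ _ _ _ _ (is_derive_coord b s v)).
  move=> D; apply: is_derive_eq (is_deriveZ (v 0 a) D) _.
  congr (_ * _); rewrite mxE; apply: eq_bigr => b _;
    rewrite [jacobian_mx _ _ _ _]mxE.
  by congr (_ * _); exact: (@derive_val _ _ _ _ _ _ _ (is_derive_coord b s v)).
have [s _] := MVT_line (f := q) (z := t) (v := v)
  (fun r _ => @ex_derive _ _ _ _ _ _ _ (dq (t + r *: v))).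
rewrite (@derive_val _ _ _ _ _ _ _ (dq (t + s *: v))).
have -> : v *m jacobian_mx eta (t + s *: v) *m v^T =
    (v *m fisher E w (t + s *: v) *m v^T)^T.
  by rewrite !trmx_mul trmxK fisher_natural trmxK mulmxA.
rewrite [X in _ = X]mxE.
have -> : t + v = t' by rewrite /v addrC subrK.
rewrite /q tt' subrr => E0.
by have := fisher_posdef (t + s *: v) v0; rewrite -E0 ltxx.
Qed.

Lemma expectation_chart :
  exists tau : V -> V, coordinate_change setT eta tau.
Proof.
have ueta t : jacobian_mx eta t \in unitmx.
  by rewrite -unitmx_tr -fisher_natural fisher_unit.
have [tau [tauK oR sR]] :=
  inverse_function_theorem smooth_expectation inj_expectation ueta.
by exists tau; split=> //; [exact: openT|exact: smooth_expectation].
Qed.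

(** The tensor law: in the chart the metric is the natural one multiplied by the Jacobian of [phi]
    on the left and its transpose on the right. That Jacobian is invertible because [xi] after [phi]
    is the identity on an open set. *)
Lemma fisher_chart_unit U0 (xi phi : V -> V) s :
  coordinate_change U0 xi phi -> (xi @` U0) s ->
    fisher E (w \o phi) s \in unitmx.
Proof.
move=> [oU0 oU xiK sxi sphi] [t U0t <-] {s}.
have Cphi m a : Ck m (xi @` U0) (fun s => phi s 0 a).
  by have /smooth_onP := sphi a; exact.
have Cxi m a : Ck m U0 (fun s => xi s 0 a) by have /smooth_onP := sxi a; exact.
have Ceta m a : Ck m setT (fun s => eta s 0 a).
  by have /smooth_onP := smooth_expectation a; exact.
have Us : (xi @` U0) (xi t) by exists t.
have V0 : U0 (phi (xi t)) by rewrite xiK.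
rewrite (fisher_reparam oU Cphi Us).
rewrite (jacobian_comp (f := eta) openT (Cphi 1%N) (Ceta 1%N) Us I).
rewrite trmx_mul mulmxA -fisher_natural.
have uphi : jacobian_mx phi (xi t) \in unitmx.
  have := jacobian_comp oU0 (Cphi 1%N) (Cxi 1%N) Us V0.
  have -> : jacobian_mx (fun y => xi (phi y)) (xi t) = 1%:M.
    rewrite -(jacobian_id (xi t)); apply/matrixP => i l; rewrite !mxE.
    by apply: (partial_eq i oU Us) => _ [t' Ut' <-]; rewrite xiK.
  by move=> /esym/mulmx1_unit[].
by rewrite !unitmx_mul uphi fisher_unit unitmx_tr uphi.
Qed.

End GlobalStructure.

Section AffineCoordinates.
Context {R : realType} {d : nat}.
Implicit Types (G : @coefficients R d) (x : 'rV[R]_d).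

Lemma covariant_basis G i j x l :
  covariant G (fun=> basis i) (fun=> basis j) x 0 l = G i j l x.
Proof.
have b1 k : (basis k : 'rV[R]_d) 0 k = 1 by rewrite mxE !eqxx.
have b0 k m : m != k -> (basis k : 'rV[R]_d) 0 m = 0.
  by move=> mk; rewrite mxE eqxx (negbTE mk).
rewrite mxE (bigD1 i)//= b1 mul1r [X in _ + X]big1 ?addr0 => [|k ki];
  last first.
  by rewrite b0 ?mul0r.
rewrite (bigD1 j)//= b1 mul1r [X in _ + (_ + X)]big1 ?addr0 => [|k kj];
  last first.
  by rewrite b0 ?mul0r.
by rewrite [X in X + _]derive_cst add0r.
Qed.

(** Where [f] is the identity its first derivatives are Kronecker deltas and its second ones vanish,
    so the affine equation says that the coefficients are 0. Requiring this only on [U] admits the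
    expectation parameter composed with its inverse chart. *)
Lemma covariant_basis_eq0 (U : set 'rV[R]_d) (f : 'rV[R]_d ->
  'rV[R]_d) G i j x :
  open U -> U x -> (forall y, U y -> f y = y) ->
  (forall a, \sum_l G i j l x * partial l (fun t => f t 0 a) x =
             partial i (partial j (fun t => f t 0 a)) x) ->
  covariant G (fun=> basis i) (fun=> basis j) x = 0.
Proof.
move=> oU Ux fid Gf; apply/rowP => a; rewrite covariant_basis mxE.
have df k y : U y -> partial k (fun t => f t 0 a) y = (k == a)%:R.
  move=> Uy; rewrite -(partial_coord k a y).
  by apply: (partial_eq k oU Uy) => z Uz; rewrite fid.
transitivity (partial i (partial j (fun t => f t 0 a)) x); last first.
  by rewrite (partial_eq i oU Ux (df j)) [LHS]derive_cst.
rewrite -Gf (bigD1 a)//= df// eqxx mulr1 big1 ?addr0// => l la.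
by rewrite df// (negbTE la) mulr0.
Qed.

End AffineCoordinates.

Theorem theorem5 (R : realType) (X : finType) (E : rel X)
    (cardX : (2 <= #|X|)%N) (connE : strongly_connected E)
    (d : nat) (w : 'rV[R]_d -> X -> X -> R)
    (C : X -> X -> R) (F : 'I_d -> X -> X -> R)
    (K : 'rV[R]_d -> X -> R) (psi : 'rV[R]_d -> R)
    (expw : exponential_family E w C F K psi) :
  [/\ riemannian_family E w,
      flat w (exp_connection E), flat w (mix_connection E),
      affine_coordinates w (exp_connection E) id &
      affine_coordinates w (mix_connection E) (expectation_parameter E w F)].
Proof.
have [wE inj_w ln_w] := expw.
have [x0 _] : exists x0, x0 \in X by apply/card_gt0P; exact: leq_trans cardX.
have unit_id s : setT s -> fisher E (w \o id) s \in unitmx.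
  by move=> _; exact: (fisher_unit connE x0 wE inj_w ln_w).
split.
- split=> [x y|t v]; first exact: (smooth_family connE x0 wE ln_w).
  exact: (fisher_posdef connE x0 wE inj_w ln_w).
- move=> U xi phi cc; have [_ oU _ _ sphi] := cc.
  apply: (flat_on_exp_reparam connE x0 wE ln_w oU).
    by move=> m a; have /smooth_onP := sphi a; exact.
  by move=> s; exact: (fisher_chart_unit connE x0 wE inj_w ln_w cc).
- move=> U xi phi cc; have [_ oU _ _ sphi] := cc.
  apply: (flat_on_mix_reparam connE x0 wE ln_w oU).
    by move=> m a; have /smooth_onP := sphi a; exact.
  by move=> s; exact: (fisher_chart_unit connE x0 wE inj_w ln_w cc).
- have sid : smooth_map_on [set: 'rV[R]_d] id.
    by move=> a; apply/smooth_onP => m; exact: (Ck_coord _ _ openT).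
  have rid : range (id : 'rV[R]_d -> 'rV[R]_d) = setT by rewrite image_id.
  exists id => [|i j x _]; first by split; rewrite ?rid//; exact: openT.
  apply: (covariant_basis_eq0 openT I (fun y _ => erefl y)) => a.
  apply: (exp_affine_reparam connE x0 wE ln_w openT _ i j a unit_id I) => m b.
  exact: (Ck_coord _ _ openT).
- have [tau cc] := expectation_chart connE x0 wE inj_w ln_w.
  have [_ oR etaK _ stau] := cc.
  (* In this chart the affine functions are the expectation parameter after [tau], known to be the
     identity only on the open range. *)
  exists tau => // i j x Rx.
  apply: (covariant_basis_eq0
    (f := fun y => expectation_parameter E w F (tau y)) oR Rx).
    by move=> _ [t _ <-]; rewrite etaK.
  move=> a; apply: (mix_affine_reparam connE x0 wE ln_w oR _ i j a _ Rx).
    by move=> m b; have /smooth_onP := stau b; exact.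
  by move=> s; exact: (fisher_chart_unit connE x0 wE inj_w ln_w cc).
Qed.
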